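(* Oeljeklaus–Toma manifolds (of any type $(s,t)$ with integers $s>0$, $t>0$) do not admit Vaisman metrics.
   Context: Oeljeklaus–Toma (OT) manifolds. Let $s,t>0$ be integers and let $K$ be an extension field of $\mathbb{Q}$ of degree $s+2t$ with embeddings $\sigma_1,\dots,\sigma_{s+2t}$ into $\mathbb{C}$ such that $\sigma_1,\dots,\sigma_s$ are real and $\sigma_{s+1},\dots,\sigma_{s+2t}$ are complex (non-real) with $\sigma_{s+i}=\overline{\sigma_{s+i+t}}$ for $1\le i\le t$. Let $\mathcal{O}_K$ be the ring of algebraic integers of $K$, $\mathcal{O}_K^*$ its group of units, and $\mathcal{O}_K^{*\,+}=\{a\in\mathcal{O}_K^*:\sigma_i(a)>0 \text{ for all } 1\le i\le s\}$. Define $l:\mathcal{O}_K^{*\,+}\to\mathbb{R}^{s+t}$ by $$l(a)=(\log|\sigma_1(a)|,\dots,\log|\sigma_s(a)|,2\log|\sigma_{s+1}(a)|,\dots,2\log|\sigma_{s+t}(a)|).$$ Its image is a lattice in $L=\{x\in\mathbb{R}^{s+t}:\sum_i x_i=0\}$. Let $p:L\to\mathbb{R}^s$ be the projection to the first $s$ coordinates, and let $U\subset\mathcal{O}_K^{*\,+}$ be a subgroup of rank $s$ such that $p(l(U))$ is a lattice in $\mathbb{R}^s$ (such $U$ exists). Let $H=\{z\in\mathbb{C}:\mathrm{Im}\,z>0\}$. The group $U\ltimes\mathcal{O}_K$ acts on $H^s\times\mathbb{C}^t$ by $$(a,b)\cdot(w_1,\dots,w_s,z_1,\dots,z_t)=(\sigma_1(a)w_1+\sigma_1(b),\dots,\sigma_s(a)w_s+\sigma_s(b),\sigma_{s+1}(a)z_1+\sigma_{s+1}(b),\dots,\sigma_{s+t}(a)z_t+\sigma_{s+t}(b)).$$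 The quotient $(H^s\times\mathbb{C}^t)/(U\ltimes\mathcal{O}_K)$ is a compact complex manifold, called an OT-manifold of type $(s,t)$. A Hermitian metric $g$ on a complex manifold $(M,J)$, with fundamental form $\omega=g(-,J-)$, is locally conformal Kähler (LCK) if there is a closed $1$-form $\theta$ (the Lee form) with $d\omega=\theta\wedge\omega$; it is always assumed that $\theta\neq0$ and that $\theta$ is not exact. An LCK metric is Vaisman if $\nabla\theta=0$ for the Levi-Civita connection $\nabla$ of $g$. *)

(* Defs.v *)
From HB Require Import structures.
From mathcomp Require Import all_boot all_order all_algebra all_field.
From mathcomp Require Import complex.
From mathcomp Require Import all_classical all_reals all_analysis.
Import Order.TTheory GRing.Theory Num.Theory numFieldNormedType.Exports.

Set Implicit Arguments.
Unset Strict Implicit.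
Unset Printing Implicit Defensive.

Local Open Scope classical_set_scope.
Local Open Scope ring_scope.

(* C^n is modelled on the real normed space R^(n + n): the point
   row_mx x y stands for x + i y, and vectors are rows. *)
Definition of_complex (R : realType) (n : nat) (z : 'rV[R[i]]_n) :
    'rV[R]_(n + n) :=
  row_mx (map_mx (@complex.Re R) z) (map_mx (@complex.Im R) z).

Definition to_complex (R : realType) (n : nat) (x : 'rV[R]_(n + n)) :
    'rV[R[i]]_n :=
  \row_j (x 0 (lshift n j) +i* x 0 (rshift n j))%C.

(* v *m Jmx is i v. *)
Definition Jmx (R : realType) (n : nat) : 'M[R]_(n + n) :=
  block_mx 0 1%:M (- 1%:M) 0.

(* Complex differentiability: the real differential is C-linear. *)
Definition holomorphic_on (R : realType) (m n : nat)
    (A : set 'rV[R]_(m + m)) (f : 'rV[R]_(m + m) -> 'rV[R]_(n + n)) : Prop :=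
  forall x, A x -> differentiable f x /\
    Jmx R m *m jacobian f x = jacobian f x *m Jmx R n.

Definition partial (R : realType) (N : nat) (k : 'I_N) (f : 'rV[R]_N -> R)
    (x : 'rV[R]_N) : R :=
  'D_(delta_mx 0 k) f x.

(* C^oo on an open set A: every iterated partial derivative is differentiable
   at every point of A. *)
Definition smooth_on (R : realType) (N : nat) (A : set 'rV[R]_N)
    (f : 'rV[R]_N -> R) : Prop :=
  forall (ks : seq 'I_N) x, A x -> differentiable (foldr (@partial R N) f ks) x.

(* The values of cchart c outside cdom c, and of cinv c outside the image of
   cdom c, are irrelevant. *)
Record complexManifold (R : realType) (n : nat) := ComplexManifold {
  cpoint :> topologicalType;
  cchart_index : Type;
  cdom : cchart_index -> set cpoint;
  cchart : cchart_index -> cpoint -> 'rV[R]_(n + n);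
  cinv : cchart_index -> 'rV[R]_(n + n) -> cpoint;
  chausdorff : hausdorff_space cpoint;
  csecond_countable : @second_countable cpoint;
  ccover : forall p, exists c, cdom c p;
  cdom_open : forall c, open (cdom c);
  cimage_open : forall c, open (cchart c @` cdom c);
  cchartK : forall c p, cdom c p -> cinv c (cchart c p) = p;
  cchart_continuous : forall c p, cdom c p -> {for p, continuous (cchart c)};
  cinv_continuous : forall c x, (cchart c @` cdom c) x ->
    {for x, continuous (cinv c)};
  ctransition : forall c d,
    holomorphic_on (cchart c @` (cdom c `&` cdom d)) (cchart d \o cinv c) }.

Section Tensors.
Variables (R : realType) (n : nat) (M : complexManifold R n).

Local Notation E := 'rV[R]_(n + n).
Local Notation I := (cchart_index M).
Implicit Types (c d : I) (x : E).

Definition cimage c : set E := cchart c @` cdom c.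
Definition coverlap c d : set E := cchart c @` (cdom c `&` cdom d).
Definition transition c d : E -> E := cchart d \o cinv c.

(* Tensor fields are given by their components in every chart, related by the
   transformation law on overlaps.  A 1-form has components
   theta c x k 0 = theta(e_k), a bilinear form has components
   g c x i j = g(e_i, e_j), for the real coordinate frame (e_k). *)
Definition one_form_components := I -> E -> 'cV[R]_(n + n).
Definition bilinear_components := I -> E -> 'M[R]_(n + n).
Implicit Types (theta : one_form_components) (g omega : bilinear_components).

Definition is_one_form theta : Prop :=
  (forall c k, smooth_on (cimage c) (fun x => theta c x k 0)) /\
  (forall c d x, coverlap c d x ->
     theta c x = jacobian (transition c d) x *m theta d (transition c d x)).

Definition is_bilinear_form g : Prop :=
  (forall c i j, smooth_on (cimage c) (fun x => g c x i j)) /\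
  (forall c d x, coverlap c d x ->
     g c x = jacobian (transition c d) x *m g d (transition c d x)
               *m (jacobian (transition c d) x)^T).

Definition hermitian_metric g : Prop :=
  [/\ is_bilinear_form g,
      forall c x, cimage c x -> (g c x)^T = g c x,
      forall c x, cimage c x ->
        forall v : E, v != 0 -> 0 < (v *m g c x *m v^T) 0 0 &
      forall c x, cimage c x -> Jmx R n *m g c x *m (Jmx R n)^T = g c x].

(* omega(u, v) = g(u, J v) *)
Definition fundamental_form g : bilinear_components :=
  fun c x => g c x *m (Jmx R n)^T.

Definition closed_one_form theta : Prop :=
  forall c x, cimage c x -> forall i j,
    partial i (fun y => theta c y j 0) x = partial j (fun y => theta c y i 0) x.

Definition smooth_function (f : M -> R) : Prop :=
  forall c, smooth_on (cimage c) (f \o cinv c).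

Definition exact_one_form theta : Prop :=
  exists2 f : M -> R, smooth_function f &
    forall c x, cimage c x -> forall k, theta c x k 0 = partial k (f \o cinv c) x.

(* Exterior derivative of a 2-form and wedge product of a 1-form and a 2-form,
   evaluated on (e_i, e_j, e_k). *)
Definition ext_deriv2 omega c x (i j k : 'I_(n + n)) : R :=
  partial i (fun y => omega c y j k) x + partial j (fun y => omega c y k i) x
  + partial k (fun y => omega c y i j) x.

Definition wedge12 theta omega c x (i j k : 'I_(n + n)) : R :=
  theta c x i 0 * omega c x j k + theta c x j 0 * omega c x k i
  + theta c x k 0 * omega c x i j.

Definition lck_with_lee_form g theta : Prop :=
  [/\ hermitian_metric g,
      is_one_form theta /\ closed_one_form theta,
      forall c x, cimage c x -> forall i j k,
        ext_deriv2 (fundamental_form g) c x i j k =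
        wedge12 theta (fundamental_form g) c x i j k,
      ~ (forall c x, cimage c x -> theta c x = 0) &
      ~ exact_one_form theta].

(* Symbols of the Levi-Civita connection:
   nabla_(e_i) e_j = \sum_k christoffel g c x i j k *: e_k. *)
Definition christoffel g c x (i j k : 'I_(n + n)) : R :=
  2^-1 * \sum_(l < n + n) invmx (g c x) k l *
    (partial i (fun y => g c y j l) x + partial j (fun y => g c y i l) x
     - partial l (fun y => g c y i j) x).

(* (nabla_(e_i) theta)(e_j) *)
Definition cov_deriv g theta c x (i j : 'I_(n + n)) : R :=
  partial i (fun y => theta c y j 0) x
  - \sum_(k < n + n) christoffel g c x i j k * theta c x k 0.

Definition vaisman_metric g : Prop :=
  exists2 theta, lck_with_lee_form g theta &
    forall c x, cimage c x -> forall i j, cov_deriv g theta c x i j = 0.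

Definition admits_vaisman_metric : Prop := exists g, vaisman_metric g.

(* pi presents M as the quotient of the open set X of C^n by an equivalence
   relation: it is onto, its fibres are the classes, and it is locally
   biholomorphic, which determines the complex structure of M. *)
Definition holomorphic_map_on (X : set E) (f : E -> M) : Prop :=
  forall x, X x -> {for x, continuous f} /\
    forall c, cdom c (f x) -> holomorphic_on [set x] (cchart c \o f).

Definition locally_biholomorphic_on (X : set E) (f : E -> M) : Prop :=
  holomorphic_map_on X f /\
  forall x, X x -> exists V : set E, exists h : M -> E,
    [/\ open V, V x & V `<=` X] /\
    [/\ open (f @` V), forall y, V y -> h (f y) = y &
        forall c, holomorphic_on (cchart c @` (cdom c `&` f @` V)) (h \o cinv c)].

Definition complex_quotient (X : set E) (rel : E -> E -> Prop) (pi : E -> M) :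
    Prop :=
  [/\ forall p : M, exists2 x, X x & pi x = p,
      forall x y, X x -> X y -> (pi x = pi y <-> rel x y) &
      locally_biholomorphic_on X pi].

End Tensors.

Section OeljeklausToma.
Variables (R : realType) (s t : nat) (K : fieldExtType rat).
Variable sigma : 'I_(s + t + t) -> {rmorphism K -> R[i]}.

(* sigma_1, ..., sigma_s are the first s indices, followed by the t indices of
   sigma_(s+1), ..., sigma_(s+t) and then by those of their conjugates.
   Since [K : Q] = s + 2t, distinctness makes these all the embeddings. *)
Definition ordered_embeddings : Prop :=
  [/\ forall i j, (forall a, sigma i a = sigma j a) -> i = j,
      forall (i : 'I_s) a, complex.Im (sigma (lshift t (lshift t i)) a) = 0,
      forall i : 'I_t,
        (exists a, complex.Im (sigma (lshift t (rshift s i)) a) != 0) /\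
        (exists a, complex.Im (sigma (rshift (s + t) i) a) != 0) &
      forall (i : 'I_t) a, sigma (lshift t (rshift s i)) a =
        conjc (sigma (rshift (s + t) i) a)].

Definition algebraic_integers : set K :=
  [set a | integralOver (intr : int -> K) a].

Definition algebraic_units : set K :=
  [set a | [/\ a != 0, algebraic_integers a & algebraic_integers a^-1]].

Definition positive_units : set K :=
  [set a | algebraic_units a /\
           forall i : 'I_s, 0 < sigma (lshift t (lshift t i)) a].

Definition log_embedding (a : K) : 'rV[R]_(s + t) :=
  row_mx
    (\row_(i < s) ln (complex.Re `|sigma (lshift t (lshift t i)) a|))
    (\row_(i < t) (2 * ln (complex.Re `|sigma (lshift t (rshift s i)) a|))).

(* Full lattices: Z-spans of bases. *)
Definition is_lattice (m : nat) (L : set 'rV[R]_m) : Prop :=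
  exists2 B : 'M[R]_m, B \in unitmx &
    L = [set v | exists c : 'rV[int]_m, v = map_mx (intr : int -> R) c *m B].

Definition mult_independent (r : nat) (a : 'I_r -> K) : Prop :=
  forall m : 'I_r -> int, \prod_(i < r) a i ^ m i = 1 -> forall i, m i = 0.

Definition has_rank (U : set K) (r : nat) : Prop :=
  (exists2 a : 'I_r -> K, forall i, U (a i) & mult_independent a) /\
  (forall (q : nat) (a : 'I_q -> K),
     (forall i, U (a i)) -> mult_independent a -> (q <= r)%N).

Definition admissible_subgroup (U : set K) : Prop :=
  [/\ U `<=` positive_units,
      U 1 /\ (forall a b, U a -> U b -> U (a * b) /\ U a^-1),
      has_rank U s &
      is_lattice [set (lsubmx (log_embedding a) : 'rV[R]_s) | a in U]].

(* H^s x C^t *)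
Definition ot_domain : set 'rV[R]_((s + t) + (s + t)) :=
  [set x | forall i : 'I_s, 0 < complex.Im (to_complex x 0 (lshift t i))].

Definition ot_action (a b : K) (x : 'rV[R]_((s + t) + (s + t))) :
    'rV[R]_((s + t) + (s + t)) :=
  of_complex (\row_(j < s + t)
    (sigma (lshift t j) a * to_complex x 0 j + sigma (lshift t j) b)).

Definition is_OT_manifold (U : set K) (M : complexManifold R (s + t)) : Prop :=
  exists pi : 'rV[R]_((s + t) + (s + t)) -> M,
    complex_quotient ot_domain
      (fun x y => exists a b,
         [/\ U a, algebraic_integers b & y = ot_action a b x]) pi.

End OeljeklausToma.

(* Main.v *)
Require Import Defs.
From HB Require Import structures.
From mathcomp Require Import all_boot all_order all_algebra all_field.
From mathcomp Require Import complex.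
From mathcomp Require Import all_classical all_reals all_analysis.
From mathcomp Require Import ring lra.
Import Order.TTheory GRing.Theory Num.Theory numFieldNormedType.Exports.

(** Write X for the domain H^s x C^t, let g be a Vaisman metric on the quotient
    and theta its Lee form. The pullback alpha of theta to X is closed and X is
    convex, so alpha = d Phi ([lee_potential]). Two facts about Phi contradict
    each other.

    Phi has a minimum along a complex line. Each (a, b) changes Phi by a
    constant ([deck_potential_shift]). Conjugating the translation by b with a
    gives the translation by a b, so both have the same constant, and Phi is
    invariant under the translations by (a - 1) O_K for every a in U
    ([potential_period]). Take a different from 1, which exists as U has rank
    s > 0. The embeddings of K being linearly independent, (a - 1) O_K spans
    R^s x C^t over R ([embeddings_span]); so on a fibre of (w, z) |-> Im w the
    function Phi comes from a compact torus, and it has a minimum at some point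
    p of the fibre. As t > 0, the fibre contains the complex line through p in
    the direction of a coordinate z_i.

    On the other hand psi = exp (- Phi) is strictly plurisubharmonic. The
    equation nabla theta = 0 expresses the Hessian of Phi through the first
    derivatives of g. Contracting d omega = theta /\ omega with v, J v and the
    vector dual to theta turns this into a formula for the Levi form of Phi
    ([levi_identity]),

    Hess Phi (v, v) + Hess Phi (J v, J v) = theta(v)^2 + theta(J v)^2 -
    |theta|^2 g(v, v),

    so that the Levi form of psi is psi |theta|^2 g. Being parallel, theta has
    constant norm ([lee_norm2_const]), which is nonzero because theta is. By the
    maximum principle the restriction of psi to the complex line cannot have a
    maximum at p ([no_leaf_minimum]).

    The quotient map is given as complex differentiable at each point, so
    neither alpha nor psi is known to be smooth on X, and the maximum principle
    is proved in a chart of the quotient. There psi >= psi(p) + Re P + c |h|^2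
    for a holomorphic quadratic polynomial P vanishing at p and some c > 0
    ([pluriharmonic_lower_bound]). At a maximum of psi along the line, the
    pullback of P to the line would be a complex differentiable function of
    zeta, zero at zeta = 0, whose real part is negative for small zeta <> 0. In
    the coordinate log zeta the mean of this real part over a period does not
    depend on Re log zeta ([periodic_mean_zero]); it tends to 0, so the real
    part has zeros. This uses Goursat's lemma ([goursat]) in the following form:
    a 1-form which is differentiable at each point, with symmetric Jacobian, has
    primitives on balls. The same lemma gives Phi, once primitives on balls are
    glued along segments ([global_primitive]). *)

Set Implicit Arguments.
Unset Strict Implicit.
Unset Printing Implicit Defensive.

Local Open Scope classical_set_scope.
Local Open Scope ring_scope.

(** * Functions along segments *)

Definition segment_convex (R : realType) (V : normedModType R) (A : set V) :
    Prop :=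
  forall x y (t : R), A x -> A y -> 0 <= t <= 1 -> A (x + t *: (y - x)).

Lemma convex_comb_lt (R : realType) (s x y d : R) :
  0 <= s -> s <= 1 -> x < d -> y < d -> (1 - s) * x + s * y < d.
Proof.
move=> s0 s1 xd yd; have [sE|sN] := eqVneq s 0; first by rewrite sE; lra.
by have : 0 < s by [rewrite lt_neqAle eq_sym sN]; nra.
Qed.

Lemma conv_combE (R : pzRingType) (V : lmodType R) (s : R) (a b : V) :
  (1 - s) *: a + s *: b = a + s *: (b - a).
Proof. by rewrite scalerBl scale1r -addrA [- _ + _]addrC -scalerBr. Qed.

Lemma ball_convex (R : realType) (V : normedModType R) (x : V) (r : R) :
  segment_convex (ball x r).
Proof.
move=> u v e; rewrite -!ball_normE /= => ur vr /andP[e0 e1].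
have -> : x - (u + e *: (v - u)) = (1 - e) *: (x - u) + e *: (x - v).
  rewrite conv_combE opprD addrA -scalerN opprB; congr (_ + _ *: _).
  by rewrite opprB [RHS]addrC addrA subrK.
apply: le_lt_trans (ler_normD _ _) _; rewrite !normrZ !ger0_norm ?subr_ge0 //.
exact: convex_comb_lt.
Qed.

Lemma ball_subball (R : realType) (V : normedModType R) (x : V) (r : R) z :
  ball x r z -> exists2 e : R, 0 < e & ball z e `<=` ball x r.
Proof.
rewrite -ball_normE /= => xz; exists (r - `|x - z|); first by rewrite subr_gt0.
move=> y /= zy.
by rewrite -(subrKA z); apply: le_lt_trans (ler_normD _ _) _;
  rewrite addrC -ltrBrDr.
Qed.

Lemma is_diff_line (R : realType) (V : normedModType R) (f df : V -> R)
    (x v : V) (t : R) :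
  is_diff (x + t *: v) f df -> is_derive t 1 (fun r => f (x + r *: v)) (df v).
Proof.
move=> fd.
have gd : is_diff t (fun r : R => x + r *: v) ( *:%R ^~ v).
  have -> : (fun r : R => x + r *: v) = cst x + *:%R ^~ v by [].
  apply: (is_diff_eq (is_diffD (is_diff_cst x t) (is_diff_scalel t v))).
  exact: add0r.
have fgd := @is_diff_comp _ _ _ _ _ _ _ _ t gd fd.
apply: DeriveDef.
  by apply/derivable1_diffP; exact: (@ex_diff _ _ _ _ _ _ _ fgd).
rewrite deriveE; last exact: (@ex_diff _ _ _ _ _ _ _ fgd).
by rewrite (@diff_val _ _ _ _ _ _ _ fgd) /= scale1r.
Qed.

Lemma MVT_line (R : realType) (V : normedModType R) (f : V -> R)
    (df : V -> V -> R) (x v : V) :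
  (forall t : R, 0 <= t <= 1 -> is_diff (x + t *: v) f (df (x + t *: v))) ->
  exists2 t : R, 0 <= t <= 1 & f (x + v) - f x = df (x + t *: v) v.
Proof.
move=> fd.
have fl (t : R) : t \in `[0, 1]%R ->
    is_derive t 1 (fun r => f (x + r *: v)) (df (x + t *: v) v).
  by rewrite in_itv /= => /fd; exact: is_diff_line.
have oc (t : R) : t \in `]0, 1[%R -> t \in `[0, 1]%R by exact: subset_itv_oo_cc.
have cl : {within `[0, 1], continuous (fun r => f (x + r *: v))}.
  apply: derivable_within_continuous => t tI.
  exact: (@ex_derive _ _ _ _ _ _ _ (fl _ tI)).
have [t t01 e] := @MVT R (fun r => f (x + r *: v))
  (fun t => df (x + t *: v) v) 0 1 ltr01 (fun t tI => fl t (oc t tI)) cl.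
exists t; first by move: t01; rewrite in_itv /= => /andP[/ltW -> /ltW ->].
by rewrite scale1r scale0r addr0 subr0 mulr1 in e.
Qed.

Lemma diff0_constant (R : realType) (V : normedModType R) (A : set V)
    (f : V -> R) (x y : V) : segment_convex A ->
  (forall z, A z -> is_diff z f 0) -> A x -> A y -> f x = f y.
Proof.
move=> cA f0 Ax Ay.
have [t _] := @MVT_line _ _ f (fun _ => 0) x (y - x)
  (fun t t01 => f0 _ (cA _ _ _ Ax Ay t01)).
by rewrite [x + _]addrC subrK => /eqP; rewrite subr_eq0 => /eqP ->.
Qed.

Lemma same_primitive (R : realType) (V : normedModType R) (A : set V)
    (f g : V -> R) (al : V -> V -> R) (x y : V) : segment_convex A ->
  (forall z, A z -> is_diff z f (al z)) ->
  (forall z, A z -> is_diff z g (al z)) -> A x -> A y ->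
  f y - f x = g y - g x.
Proof.
move=> cA fP gP Ax Ay.
have fg0 z : A z -> is_diff z (f - g) 0.
  by move=> Az; exact: (is_diff_eq (is_diffB (fP z Az) (gP z Az)) (subrr _)).
have := diff0_constant cA fg0 Ax Ay.
rewrite -![(_ - _ : _ -> _) _]/(_ - _); lra.
Qed.

Lemma continuous_primitive (R : realType) (f : R -> R) : continuous f ->
  exists F : R -> R, forall t : R, t \in `[0, 1]%R -> is_derive t 1 F (f t).
Proof.
move=> cf.
(* Starting at -1 and ending at 2 makes both ends of [0, 1] interior points,
   where the fundamental theorem of calculus gives two-sided derivatives. *)
exists (fun x => (\int[lebesgue_measure]_(t in [set` `[-1, x]]) (f t))%R).
move=> t; rewrite in_itv /= => /andP[t0 t1].
have [|||| d e] := @continuous_FTC1_closed R f (-1) t 2.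
- lra.
- apply: continuous_compact_integrable; first exact: segment_compact.
  exact: continuous_subspaceT.
- lra.
- exact: cf.
apply: (DeriveDef d); rewrite -derive1E; exact: e.
Qed.

(** * Linear forms and first-order expansions *)

(** Components of 1-forms are columns; a column M acts on row vectors as the
    linear form h |-> h M. *)
Definition covec (R : realType) (N : nat) (M : 'cV[R]_N) (h : 'rV[R]_N) : R :=
  (h *m M) 0 0.

Lemma covec_is_linear (R : realType) (N : nat) (M : 'cV[R]_N) :
    linear (covec M).
Proof. by move=> k u v; rewrite /covec mulmxDl -scalemxAl !mxE. Qed.

Lemma covecE (R : realType) (N : nat) (M : 'cV[R]_N) (h : 'rV[R]_N) :
  covec M h = \sum_k h 0 k * M k 0.
Proof. by rewrite /covec mxE. Qed.

Lemma covecD (R : realType) (N : nat) (M : 'cV[R]_N) h h' : covec M (h + h') =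
    covec M h + covec M h'.
Proof. by rewrite /covec mulmxDl mxE. Qed.

Lemma covecZ (R : realType) (N : nat) (M : 'cV[R]_N) k h : covec M (k *: h) =
    k * covec M h.
Proof. by rewrite /covec -scalemxAl mxE. Qed.

Lemma covecB (R : realType) (N : nat) (M : 'cV[R]_N) h h' : covec M (h - h') =
    covec M h - covec M h'.
Proof. by rewrite covecD -scaleN1r covecZ mulN1r. Qed.

Lemma covec_mulmx (R : realType) (N N' : nat) (J : 'M[R]_(N, N')) M h :
  covec (J *m M) h = covec M (h *m J).
Proof. by rewrite /covec mulmxA. Qed.

Lemma covec_delta (R : realType) (N : nat) (M : 'cV[R]_N) k :
  covec M (delta_mx 0 k) = M k 0.
Proof.
rewrite covecE (bigD1 k) //= big1 => [|i /negPf ik];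
  rewrite mxE ?eqxx ?mul1r ?addr0 //.
by rewrite ik andbF mul0r.
Qed.

Lemma coord_le_norm (R : realType) (m n : nat) (M : 'M[R]_(m, n)) i j :
    `|M i j| <= `|M|.
Proof.
by rewrite [leRHS]/Num.Def.normr /= mx_normrE;
  exact: (le_bigmax _ (fun ij => `|M ij.1 ij.2|) (i, j)).
Qed.

Lemma norm_mulmx_le (R : realType) (m n p : nat) (A : 'M[R]_(m, n))
    (B : 'M[R]_(n, p)) :
  `|A *m B| <= n%:R * `|A| * `|B|.
Proof.
rewrite [leLHS]/Num.Def.normr /= mx_normrE; apply/bigmax_leP;
  split => [|[i j] _ /=].
  by rewrite !mulr_ge0.
rewrite mxE; apply: le_trans (ler_norm_sum _ _ _) _.
apply: (@le_trans _ _ (\sum_(k < n) (`|A| * `|B|))).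
  by apply: ler_sum => k _; rewrite normrM ler_pM ?coord_le_norm.
by rewrite sumr_const card_ord mulr_natl mulrnAl.
Qed.

Lemma covec_le (R : realType) (N : nat) (M : 'cV[R]_N) (h : 'rV[R]_N) :
  `|covec M h| <= N%:R * `|M| * `|h|.
Proof.
apply: le_trans (coord_le_norm _ _ _) _; apply: le_trans (norm_mulmx_le _ _) _.
by rewrite mulrAC.
Qed.

Lemma covec_continuous (R : realType) (N : nat) (M : 'cV[R]_N) :
  continuous (covec M).
Proof.
move=> y; apply/(@cvgrPdist_le _ _ _ (nbhs y)) => e e0; apply/nbhs_ballP.
have C0 : 0 < N%:R * `|M| + 1 by rewrite ltr_wpDl // mulr_ge0.
exists (e / (N%:R * `|M| + 1)) => [|z /=]; first exact: divr_gt0.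
rewrite -ball_normE /= ltr_pdivlMr // => yz.
rewrite -covecB; apply: le_trans (covec_le M (y - z)) _.
apply: le_trans (ltW yz); rewrite mulrC ler_wpM2l //.
by rewrite lerDl.
Qed.

(** All estimates below are made on this epsilon-delta form of
    differentiability. *)
Lemma is_diff_littleo (R : realType) (V W : normedModType R) (f df : V -> W)
    (x : V) (e : R) : is_diff x f df -> 0 < e ->
  exists2 d : R, 0 < d & forall h, `|h| < d ->
     `|f (x + h) - f x - df h| <= e * `|h|.
Proof.
move=> [fd dE] e0; have /diff_locally/eqaddoP/(_ e e0) := fd.
rewrite dE => /nbhs_ballP[d /= d0 dH]; exists d => // h hd.
have := dH h; rewrite -ball_normE /= sub0r normrN => /(_ hd).
rewrite -![(_ - _ : _ -> _) _]/(_ - _) /=.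
by rewrite [h + x]addrC opprD addrA.
Qed.

Lemma continuous_dist (R : realType) (V W : normedModType R) (f : V -> W)
    (x : V) :
  {for x, continuous f} -> forall e : R, 0 < e ->
  exists2 d : R, 0 < d & forall y, `|y - x| < d -> `|f y - f x| < e.
Proof.
move=> /cvgrPdist_lt fx e e0; have /nbhs_ballP[d d0 dP] := fx e e0.
exists d => // y yx; rewrite distrC; apply: dP.
by rewrite -ball_normE /= distrC.
Qed.

Lemma linear_is_diff (R : realType) (V W : normedModType R) (f : V -> W)
    (x : V) (L : {linear V -> W}) : continuous L ->
  (forall e : R, 0 < e -> exists2 d : R, 0 < d & forall h, `|h| < d ->
     `|f (x + h) - f x - L h| <= e * `|h|) ->
  is_diff x f L.
Proof.
move=> cL H.
have E : f \o shift x = cst (f x) + L +o_ (0 : V) id.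
  apply/eqaddoP => e e0; have [d d0 dH] := H e e0.
  apply/nbhs_ballP; exists d => //= h.
  rewrite -ball_normE /= sub0r normrN => hd.
  rewrite -![(_ - _ : _ -> _) _]/(_ - _) /=.
  by have := dH h hd; rewrite [h + x]addrC opprD addrA.
have dL : 'd f x = L :> (V -> W) by exact: diff_unique.
apply: DiffDef; last by rewrite dL.
by apply/diff_locallyP; rewrite dL.
Qed.

Lemma near_eq_is_diff (R : realType) (V W : normedModType R) (f g df : V -> W)
    (x : V) (r : R) : 0 < r -> (forall y, ball x r y -> f y = g y) ->
  is_diff x f df -> is_diff x g df.
Proof.
move=> r0 fg fd.
have dE : 'd f x = df :> (V -> W) by exact: (@diff_val _ _ _ _ _ _ _ fd).
have fd' : differentiable f x by exact: (@ex_diff _ _ _ _ _ _ _ fd).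
apply: is_diff_eq dE; apply: (linear_is_diff (diff_continuous fd')) => e e0.
have [d d0 dH] := is_diff_littleo (differentiableP fd') e0.
exists (Num.min d r) => [|h]; first by rewrite lt_min d0.
rewrite lt_min => /andP[hd hr]; rewrite -!fg; first exact: dH.
  exact: ballxx.
by rewrite -ball_normE /= opprD addNKr normrN.
Qed.

Lemma covec_is_diffP (R : realType) (N : nat) (f : 'rV[R]_N -> R) (x : 'rV[R]_N)
    (M : 'cV[R]_N) :
  is_diff x f (covec M) <->
  (forall e : R, 0 < e -> exists2 d : R, 0 < d & forall h, `|h| < d ->
     `|f (x + h) - f x - covec M h| <= e * `|h|).
Proof.
split=> [fd e e0|H]; first exact: is_diff_littleo fd e0.
pose LM := GRing.isLinear.Build _ _ _ _ _ (@covec_is_linear R N M).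
pose L : {linear 'rV[R]_N -> R} := HB.pack (covec M) LM.
exact: (@linear_is_diff _ _ _ f x L (@covec_continuous R N M) H).
Qed.

(** * Integrals of 1-forms along segments *)

Lemma norm_trmx_le (R : realType) (m n : nat) (A : 'M[R]_(m, n)) : `|A^T| <=
    `|A|.
Proof.
rewrite [leLHS]/Num.Def.normr /= mx_normrE; apply/bigmax_leP; split => // ij _.
by rewrite mxE coord_le_norm.
Qed.

(** A 1-form th closed at z: differentiable there, with symmetric Jacobian H.
    Asking for an expansion at the single point z, with no continuity of the
    Jacobian, is what lets [goursat] apply to forms built from maps that are
    only complex differentiable at each point. *)
Definition closed_at (R : realType) (N : nat) (th : 'rV[R]_N -> 'cV[R]_N)
    (z : 'rV[R]_N) : Prop :=
  exists2 H : 'M[R]_N, H^T = H &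
    forall e : R, 0 < e -> exists2 d : R, 0 < d & forall h : 'rV[R]_N, `|h| <
      d ->
      `|th (z + h) - th z - (h *m H)^T| <= e * `|h|.

Lemma closed_at_continuous (R : realType) (N : nat)
    (th : 'rV[R]_N -> 'cV[R]_N) (z : 'rV[R]_N) : closed_at th z ->
  forall e : R, 0 < e -> exists2 d : R, 0 < d & forall h : 'rV[R]_N, `|h| < d ->
    `|th (z + h) - th z| <= e.
Proof.
move=> [H _ Hd] e e0; have [d d0 dH] := Hd 1 ltr01.
pose C := 1 + N%:R * `|H|.
have C0 : 0 < C by rewrite ltr_pwDl // mulr_ge0.
exists (Num.min d (e / C)) => [|h]; first by rewrite lt_min d0 divr_gt0.
rewrite lt_min => /andP[hd]; rewrite ltr_pdivlMr // => he.
rewrite -[X in `|X|](subrK (h *m H)^T); apply: le_trans (ler_normD _ _) _.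
apply: le_trans (ltW he); rewrite /C mulrDr mulr1; apply: lerD.
  by have := dH h hd; rewrite mul1r.
apply: le_trans (norm_trmx_le _) _.
by apply: le_trans (norm_mulmx_le _ _) _; rewrite mulrCA mulrA.
Qed.

(** The first-order expansion at z of a closed form is affine with a symmetric
    linear part, hence exact; this is its primitive, up to a constant. *)
Lemma quadratic_is_diff (R : realType) (N : nat) (c : 'cV[R]_N) (H : 'M[R]_N)
    (z y : 'rV[R]_N) : H^T = H ->
  is_diff y (fun y => covec c y + 2^-1 * covec (H *m (y - z)^T) (y - z))
            (covec (c + ((y - z) *m H)^T)).
Proof.
move=> Hs; apply/covec_is_diffP => e e0.
pose C := N%:R * `|H| * N%:R + 1.
have C0 : 0 < C by rewrite ltr_wpDl // !mulr_ge0.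
exists (e / C) => [|h]; first exact: divr_gt0.
rewrite ltr_pdivlMr // => he.
have sym u v : covec (H *m u^T) v = covec (H *m v^T) u.
  rewrite /covec.
  have -> : v *m (H *m u^T) = (u *m (H *m v^T))^T.
    by rewrite !trmx_mul trmxK Hs mulmxA.
  by rewrite mxE.
have E : y + h - z = (y - z) + h by rewrite addrAC.
have lin u v w : covec (H *m (u + v)^T) w = covec (H *m u^T) w +
  covec (H *m v^T) w.
  by rewrite /covec linearD /= !mulmxDr mxE.
have -> : covec c (y + h) + 2^-1 * covec (H *m (y + h - z)^T) (y + h - z) -
    (covec c y + 2^-1 * covec (H *m (y - z)^T) (y - z)) -
    covec (c + ((y - z) *m H)^T) h = 2^-1 * covec (H *m h^T) h.
  rewrite E; move: (y - z) => w; rewrite !covecD !lin.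
  have -> : covec (c + (w *m H)^T) h = covec c h + covec (H *m w^T) h.
    by rewrite trmx_mul Hs /covec mulmxDr mxE.
  by rewrite (sym h w); field.
apply: (@le_trans _ _ `|covec (H *m h^T) h|).
  rewrite normrM ler_piMl // ger0_norm ?invf_le1 ?ler1n //.
apply: le_trans (covec_le _ _) _; rewrite ler_wpM2r //.
apply: le_trans (ltW he).
apply: (@le_trans _ _ (N%:R * (N%:R * `|H| * `|h|))).
  rewrite ler_wpM2l //; apply: le_trans (norm_mulmx_le _ _) _.
  by rewrite ler_wpM2l ?mulr_ge0 // norm_trmx_le.
rewrite /C mulrDr mulr1 -[leLHS]addr0 lerD // le_eqVlt; apply/orP; left;
  apply/eqP; ring.
Qed.

(** Integrals along segments are increments of primitives, so this mean value
    inequality is what bounds them. *)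
Lemma is_derive_le (R : realType) (F f : R -> R) (C : R) :
  (forall t : R, 0 <= t <= 1 -> is_derive t 1 F (f t)) ->
  (forall t : R, 0 <= t <= 1 -> `|f t| <= C) -> `|F 1 - F 0| <= C.
Proof.
move=> Ff fC.
have Ff' (t : R) : t \in `]0, 1[%R -> is_derive t 1 F (f t).
  by rewrite in_itv /= => /andP[t0 t1]; apply: Ff; rewrite !ltW.
have cF : {within `[0, 1], continuous F}.
  apply: derivable_within_continuous => t; rewrite in_itv /= => tI.
  exact: (@ex_derive _ _ _ _ _ _ _ (Ff _ tI)).
have [t + ->] := @MVT R F f 0 1 ltr01 Ff' cF.
rewrite in_itv /= subr0 mulr1 => /andP[t0 t1]; apply: fC.
by rewrite !ltW.
Qed.

Lemma is_derive_affine (R : realType) (F : R -> R) (p q t d : R) :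
  is_derive (p + t * q) 1 F d -> is_derive t 1 (fun r => F (p + r * q)) (d * q).
Proof.
move=> [Fd <-].
have dF : differentiable F (p + t * q) by exact/derivable1_diffP.
have := @is_diff_line R R F _ p q t (differentiableP dF).
rewrite (diff1E dF) /= derive1E -[q *: _]/(q * _) mulrC; exact.
Qed.

(** The retraction of the line onto [0, 1]. Composition with it makes a function
    on [0, 1] continuous on the whole line. *)
Definition clip (R : realType) (t : R) : R := Num.max 0 (Num.min 1 t).

Lemma clip_lipschitz (R : realType) (r t : R) : `|clip r - clip t| <= `|t - r|.
Proof.
have H1 := ler_norm (t - r); have := ler_norm (r - t); rewrite distrC => H2.
move: (`|t - r|) H1 H2 => x H1 H2.
rewrite ler_norml /clip /Order.max /Order.min; apply/andP.
case: (ltP 1 r) => r1; case: (ltP 1 t) => t1; rewrite ?ltr01;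
  case: (ltP 0 r) => r0; case: (ltP 0 t) => t0; split; lra.
Qed.

Section SegmentIntegral.
Variables (R : realType) (N : nat) (A : set 'rV[R]_N)
  (th : 'rV[R]_N -> 'cV[R]_N).
Hypothesis cA : segment_convex A.
Hypothesis thA : forall z, A z -> closed_at th z.

Definition is_seg_primitive (a b : 'rV[R]_N) (F : R -> R) : Prop :=
  forall t : R, 0 <= t <= 1 -> is_derive t 1 F (covec (th (a + t *: (b - a)))
    (b - a)).

(** The integral of th along the segment from a to b. It is the increment of a
    primitive of the restriction of th to the segment, so that comparing
    integrals amounts to comparing functions of one variable with
    [is_derive_le]. *)
Definition seg_int (a b : 'rV[R]_N) : R :=
  let F := get (is_seg_primitive a b) in F 1 - F 0.

Lemma seg_primitive_exists a b : A a -> A b -> exists F, is_seg_primitive a b F.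
Proof.
move=> Aa Ab.
pose cl := @clip R.
have cl01 t : 0 <= cl t <= 1 by rewrite /cl /clip le_max lexx /= ge_max ler01
  ge_min lexx.
pose f t := covec (th (a + cl t *: (b - a))) (b - a).
have cf : continuous f.
  move=> t; apply/(@cvgrPdist_le _ _ _ (nbhs t)) => e e0; apply/nbhs_ballP.
  pose v := b - a.
  have [|d d0 dH] := closed_at_continuous (thA (cA Aa Ab (cl01 t)))
    (e := e / (N%:R * `|v| + 1)).
    by rewrite divr_gt0 // ltr_wpDl // mulr_ge0.
  exists (d / (`|v| + 1)) => [|r /=]; first by rewrite /= divr_gt0 // ltr_wpDl.
  rewrite -ball_normE /= ltr_pdivlMr ?ltr_wpDl // => rt.
  have /dH : `|(cl r - cl t) *: v| < d.
    rewrite normrZ; apply: le_lt_trans rt; apply: ler_pM => //;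
      last by rewrite lerDl.
    exact: clip_lipschitz.
  have -> : a + cl t *: v + (cl r - cl t) *: v = a + cl r *: v.
    by rewrite -addrA -scalerDl [cl t + _]addrC subrK.
  move=> E; rewrite distrC /f.
  have -> : covec (th (a + cl r *: (b - a))) (b - a) -
    covec (th (a + cl t *: (b - a))) (b - a)
    = covec (th (a + cl r *: v) - th (a + cl t *: v)) v.
    by rewrite /covec mulmxBr !mxE.
  apply: le_trans (covec_le _ _) _.
  have := E; rewrite ler_pdivlMr ?ltr_wpDl ?mulr_ge0 // => E';
    apply: le_trans E'.
  rewrite mulrAC mulrC ler_wpM2l // lerDl //.
have [F FP] := continuous_primitive cf.
exists F => t tI.
have := FP t; rewrite in_itv /= => /(_ tI).
rewrite /f; have -> // : cl t = t.
move: tI => /andP[t0 t1]; rewrite /cl /clip (min_idPr t1); exact/max_idPr.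
Qed.

Lemma seg_intP a b : A a -> A b ->
  exists2 F, is_seg_primitive a b F & seg_int a b = F 1 - F 0.
Proof.
move=> Aa Ab; exists (get (is_seg_primitive a b)) => //.
by have [F FP] := seg_primitive_exists Aa Ab; exact: (getPex (ex_intro _ F FP)).
Qed.

(** The exact form be = d f has integral f b - f a. Hence th has nearly this
    integral when it is close to be along the segment. *)
Lemma seg_int_le a b (f : 'rV[R]_N -> R) (be : 'rV[R]_N -> 'cV[R]_N) (e : R) :
  A a -> A b ->
  (forall t : R, 0 <= t <= 1 ->
     is_diff (a + t *: (b - a)) f (covec (be (a + t *: (b - a))))) ->
  (forall t : R, 0 <= t <= 1 ->
     `|th (a + t *: (b - a)) - be (a + t *: (b - a))| <= e) ->
  `|seg_int a b - (f b - f a)| <= N%:R * e * `|b - a|.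
Proof.
move=> Aa Ab fP fe; have [F FP ->] := seg_intP Aa Ab.
pose G := F - (fun r => f (a + r *: (b - a))).
have -> : F 1 - F 0 - (f b - f a) = G 1 - G 0.
  rewrite /G -![(_ - _ : _ -> _) _]/(_ - _) scale1r scale0r addr0 [a +
    _]addrC subrK; ring.
apply: (is_derive_le (f := fun t => covec (th (a + t *: (b - a))) (b - a)
    - covec (be (a + t *: (b - a))) (b - a))) => t tI.
  by apply: is_deriveB; [exact: FP|apply: is_diff_line; exact: fP].
have -> : covec (th (a + t *: (b - a))) (b - a) - covec (be (a + t *: (b - a)))
  (b - a)
  = covec (th (a + t *: (b - a)) - be (a + t *: (b - a))) (b - a).
  by rewrite /covec mulmxBr !mxE.
apply: le_trans (covec_le _ _) _; rewrite ler_wpM2r // ler_wpM2l //; exact: fe.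
Qed.

(** An affine change of parameter turns a primitive along a segment into one
    along a subsegment. *)
Lemma seg_int_sub a b F (p q : R) : A a -> A b -> is_seg_primitive a b F ->
  0 <= p <= 1 -> 0 <= q <= 1 ->
  seg_int (a + p *: (b - a)) (a + q *: (b - a)) = F q - F p.
Proof.
move=> Aa Ab FP pI qI.
have [G GP ->] := seg_intP (cA Aa Ab pI) (cA Aa Ab qI).
pose K := G - (fun r => F (p + r * (q - p))).
suff : `|K 1 - K 0| <= 0.
  rewrite normr_le0 /K -![(_ - _ : _ -> _) _]/(_ - _) mul1r mul0r addr0 [p +
    _]addrC subrK.
  by move/eqP => ?; lra.
apply: (is_derive_le (f := fun=> 0)) => t tI; last by rewrite normr0.
have E : a + q *: (b - a) - (a + p *: (b - a)) = (q - p) *: (b - a).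
  by rewrite opprD addrACA subrr add0r scalerBl.
have pq : 0 <= p + t * (q - p) <= 1 by nra.
have := is_deriveB (GP t tI) (is_derive_affine (FP _ pq)).
rewrite E covecZ scalerA -addrA -scalerDl mulrC subrr; exact.
Qed.

Lemma seg_int_opp a b : A a -> A b -> seg_int b a = - seg_int a b.
Proof.
move=> Aa Ab; have [F FP ->] := seg_intP Aa Ab.
have := @seg_int_sub a b F 1 0 Aa Ab FP.
rewrite scale1r scale0r addr0 [a + _]addrC subrK => ->; [ring | lra | lra].
Qed.

Lemma seg_int_split a b : A a -> A b ->
  let m := a + 2^-1 *: (b - a) in seg_int a b = seg_int a m + seg_int m b.
Proof.
move=> Aa Ab m; have [F FP ->] := seg_intP Aa Ab.
have := @seg_int_sub a b F 0 2^-1 Aa Ab FP.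
have := @seg_int_sub a b F 2^-1 1 Aa Ab FP.
rewrite scale1r scale0r addr0 [a + (b - a)]addrC subrK => -> ; [|lra|lra].
move=> ->; [ring|lra|lra].
Qed.

End SegmentIntegral.

(** * Goursat's lemma *)

Definition midpoint (R : realType) (N : nat) (a b : 'rV[R]_N) :=
    a + 2^-1 *: (b - a).

Lemma norm_add3_le (R : realType) (x y z k : R) :
  `|x| <= k -> `|y| <= k -> `|z| <= k -> `|x + y + z| <= 3 * k.
Proof.
have := ler_normD (x + y) z; have := ler_normD x y; lra.
Qed.

Lemma norm_add4_lt (R : realType) (x y z w k : R) :
  `|x| < k / 4 -> `|y| < k / 4 -> `|z| < k / 4 -> `|w| < k / 4 ->
  `|x + y + z + w| < k.
Proof.
have := ler_normD (x + y + z) w; have := ler_normD (x + y) z.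
have := ler_normD x y; lra.
Qed.

Lemma sum3_ge (R : realType) (x y z : R) : 0 <= x -> 0 <= y -> 0 <= z ->
  [/\ x <= x + y + z, y <= x + y + z & z <= x + y + z].
Proof. by move=> x0 y0 z0; split; lra. Qed.

Section Goursat.
Variables (R : realType) (N : nat) (A : set 'rV[R]_N)
  (th : 'rV[R]_N -> 'cV[R]_N).
Hypothesis cA : segment_convex A.
Hypothesis thA : forall z, A z -> closed_at th z.

Local Notation E := 'rV[R]_N.
Local Notation I := (seg_int th).
Local Notation mid := (@midpoint R N).

Definition circulation (t : E * E * E) : R :=
  I t.1.1 t.1.2 + I t.1.2 t.2 + I t.2 t.1.1.

Definition vertices_in (B : set E) (t : E * E * E) : Prop :=
  [/\ B t.1.1, B t.1.2 & B t.2].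

Definition sides_le (D : R) (t : E * E * E) : Prop :=
  [/\ `|t.1.2 - t.1.1| <= D, `|t.2 - t.1.2| <= D & `|t.1.1 - t.2| <= D].

Lemma convex_midpoint (B : set E) a b : segment_convex B -> B a -> B b ->
    B (mid a b).
Proof. by move=> cB Ba Bb; apply: cB => //; lra. Qed.

Lemma midpoint_sub_le (D : R) (u v : E) : u = 2^-1 *: v -> `|v| <= D -> `|u| <=
    D / 2.
Proof. by move=> -> vD; rewrite normrZ ger0_norm ?invr_ge0 // mulrC ler_pM2r
  ?invr_gt0. Qed.

(** The midpoints of the sides cut a triangle into four. The integrals along the
    inner edges cancel in the sum of the four circulations, so one of them is at
    least a quarter of the total. The last conclusion keeps the chosen triangle
    near the first one. The bound eta is kept apart from the circulation so that
    the statement can be iterated. *)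
Lemma circulation_quarter (B : set E) (D eta : R) t :
  segment_convex B -> B `<=` A -> vertices_in B t -> sides_le D t ->
  eta <= `|circulation t| ->
  exists t', [/\ vertices_in B t', sides_le (D / 2) t',
    eta / 4 <= `|circulation t'| & `|t'.1.1 - t.1.1| <= D].
Proof.
case: t => [[a b] c] cB BA [/= Ba Bb Bc] [/= ab bc ca] eT.
pose c' := mid a b; pose a' := mid b c; pose b' := mid c a.
have Bc' : B c' by exact: convex_midpoint.
have Ba' : B a' by exact: convex_midpoint.
have Bb' : B b' by exact: convex_midpoint.
have D0 : 0 <= D by apply: le_trans ab.
have e1 : c' - a = 2^-1 *: (b - a) by apply/rowP => j; rewrite !mxE; field.
have e2 : b' - c' = 2^-1 *: (c - b) by apply/rowP => j; rewrite !mxE; field.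
have e3 : a - b' = 2^-1 *: (a - c) by apply/rowP => j; rewrite !mxE; field.
have e4 : b - c' = 2^-1 *: (b - a) by apply/rowP => j; rewrite !mxE; field.
have e5 : a' - b = 2^-1 *: (c - b) by apply/rowP => j; rewrite !mxE; field.
have e6 : c' - a' = 2^-1 *: (a - c) by apply/rowP => j; rewrite !mxE; field.
have e7 : a' - b' = 2^-1 *: (b - a) by apply/rowP => j; rewrite !mxE; field.
have e8 : c - a' = 2^-1 *: (c - b) by apply/rowP => j; rewrite !mxE; field.
have e9 : b' - c = 2^-1 *: (a - c) by apply/rowP => j; rewrite !mxE; field.
have o1 : b' - a' = 2^-1 *: (a - b) by apply/rowP => j; rewrite !mxE; field.
have o2 : c' - b' = 2^-1 *: (b - c) by apply/rowP => j; rewrite !mxE; field.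
have o3 : a' - c' = 2^-1 *: (c - a) by apply/rowP => j; rewrite !mxE; field.
have H x y := @midpoint_sub_le D x y.
have half_le : D / 2 <= D by rewrite ler_pdivrMr // ler_peMr // ler1n.
have S : circulation (a, b, c) = circulation (a, c', b')
  + circulation (c', b, a')
   + circulation (b', a', c) + circulation (a', b', c').
  rewrite /circulation /= (seg_int_split cA thA (BA _ Ba)
    (BA _ Bb)) -/(mid a b) -/c'.
  rewrite (seg_int_split cA thA (BA _ Bb) (BA _ Bc)) -/(mid b c) -/a'.
  rewrite (seg_int_split cA thA (BA _ Bc) (BA _ Ba)) -/(mid c a) -/b'.
  rewrite (seg_int_opp cA thA (BA _ Bc') (BA _ Bb'))
    (seg_int_opp cA thA (BA _ Ba') (BA _ Bb')).
  rewrite (seg_int_opp cA thA (BA _ Bc') (BA _ Ba')).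
  clearbody a' b' c'; move: (I a c') (I c' b) (I b a') (I a' c) (I c b')
    (I b' a) => x1 x2 x3 x4 x5 x6.
  move: (I b' c') (I b' a') (I a' c') => x7 x8 x9; ring.
clearbody a' b' c'.
have [le1|lt1] := lerP (eta / 4) `|circulation (a, c', b')|.
  exists (a, c', b'); split => //=; last by rewrite subrr normr0.
  by split => /=; [exact: H e1 ab|exact: H e2 bc|exact: H e3 ca].
have [le2|lt2] := lerP (eta / 4) `|circulation (c', b, a')|.
  exists (c', b, a'); split => //=.
    by split => /=; [exact: H e4 ab|exact: H e5 bc|exact: H e6 ca].
  by apply: le_trans (H _ _ e1 ab) _; exact: half_le.
have [le3|lt3] := lerP (eta / 4) `|circulation (b', a', c)|.
  exists (b', a', c); split => //=.
    by split => /=; [exact: H e7 ab|exact: H e8 bc|exact: H e9 ca].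
  by rewrite distrC; apply: le_trans (H _ _ e3 ca) _; exact: half_le.
have [le4|lt4] := lerP (eta / 4) `|circulation (a', b', c')|.
  exists (a', b', c'); split => //=.
    split => /=.
    - by apply: H o1 _; rewrite distrC.
    - by apply: H o2 _; rewrite distrC.
    - by apply: H o3 _; rewrite distrC.
  have -> : a' - a = (a' - b') + (b' - a) by rewrite subrKA.
  apply: le_trans (ler_normD _ _) _; rewrite [in X in _ + X]distrC.
  by rewrite [leRHS]splitr; apply: lerD; [exact: H e7 ab|exact: H e3 ca].
exfalso; move: eT; rewrite S leNgt => /negP; apply.
exact: norm_add4_lt lt1 lt2 lt3 lt4.
Qed.

(** The first-order expansion of th at z is exact and contributes nothing to the
    circulation. What remains is o(s) on a triangle of size s near z, integrated
    along sides of length at most s. *)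
Lemma circulation_small (z : E) (e : R) : A z -> 0 < e ->
  exists2 d : R, 0 < d & forall s t, vertices_in A t -> sides_le s t ->
    `|t.1.1 - z| <= 2 * s -> 4 * s < d -> `|circulation t| <= e * s ^+ 2.
Proof.
move=> Az e0; have [H Hs HP] := thA Az.
(* 12 N: three sides, each at distance at most 4 s from z, and the factor N of
   [covec_le]. *)
pose K : R := 12 * N%:R + 1.
have K0 : 0 < K by rewrite ltr_wpDl // mulr_ge0.
have [d d0 dH] := HP (e / K) (divr_gt0 e0 K0).
have eK0 : 0 <= e / K by rewrite ltW // divr_gt0.
exists d => // s [[a b] c] [/= Aa Ab Ac] [/= ab bc ca] az sd.
have s0 : 0 <= s by apply: le_trans ab.
pose f y := covec (th z) y + 2^-1 * covec (H *m (y - z)^T) (y - z).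
have side u v : A u -> A v -> `|v - u| <= s -> `|u - z| <= 3 * s ->
    `|I u v - (f v - f u)| <= N%:R * (e / K * (4 * s)) * s.
  move=> Au Av uv uz.
  have near (t : R) : 0 <= t <= 1 -> `|u + t *: (v - u) - z| <= 4 * s.
    move=> /andP[t0 t1]; rewrite addrAC; apply: le_trans (ler_normD _ _) _.
    have : `|t *: (v - u)| <= s.
      by rewrite normrZ ger0_norm //; apply: le_trans uv; rewrite ler_piMl.
    by move: uz; lra.
  have := @seg_int_le _ _ A th cA thA u v f (fun y => th z + ((y - z) *m H)^T)
    (e / K * (4 * s)) Au Av.
  move=> /(_ (fun t _ => quadratic_is_diff _ _ _ Hs)) B.
  apply: le_trans (B _) _; last first.
    by apply: ler_wpM2l => //; apply: mulr_ge0 => //; apply: mulr_ge0;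
      rewrite // mulr_ge0.
  move=> t t01; rewrite opprD addrA.
  have := near t t01; move: (u + t *: (v - u)) => y yz.
  have := dH (y - z) (le_lt_trans yz sd); rewrite [z + _]addrC subrK =>
    /le_trans; apply.
  exact: ler_wpM2l.
have h1 := side a b Aa Ab ab _.
have h2 := side b c Ab Ac bc _.
have h3 := side c a Ac Aa ca _.
have az' : `|a - z| <= 3 * s by move: az; lra.
have bz' : `|b - z| <= 3 * s.
  have := ler_normD (b - a) (a - z); rewrite subrKA; lra.
have cz' : `|c - z| <= 3 * s.
  have := ler_normD (c - a) (a - z); rewrite subrKA [`|c - a|]distrC; lra.
move: (h1 az') (h2 bz') (h3 cz') => {h1 h2 h3} h1 h2 h3.
rewrite /circulation /=; clearbody f.
have -> : I a b + I b c + I c a = (I a b - (f b - f a)) + (I b c - (f c - f b))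
   + (I c a - (f a - f c)) by ring.
apply: (@le_trans _ _ (3 * (N%:R * (e / K * (4 * s)) * s))).
  exact: norm_add3_le h1 h2 h3.
have -> : 3 * (N%:R * (e / K * (4 * s)) * s) = (12 * N%:R / K) * (e * s ^+ 2)
  by field; rewrite gt_eqF.
apply: ler_piMl; first by apply: mulr_ge0; [exact: ltW|exact: sqr_ge0].
by rewrite ler_pdivrMr // mul1r /K; lra.
Qed.

Definition cball (x0 : E) (r : R) : set E := [set y | `|y - x0| <= r].

Lemma cball_convex x0 r : segment_convex (cball x0 r).
Proof.
move=> x y t xr yr /andP[t0 t1]; rewrite /cball /=.
have -> : x + t *: (y - x) - x0 = (1 - t) *: (x - x0) + t *: (y - x0).
  by apply/matrixP => i j; rewrite !mxE; ring.
apply: le_trans (ler_normD _ _) _; rewrite !normrZ !ger0_norm ?subr_ge0 //.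
by move: xr yr; rewrite /cball /=; nra.
Qed.

Lemma cball_compact x0 r : compact (cball x0 r).
Proof.
have -> : cball x0 r = closed_ball_ (fun y => `|y|) x0 r.
  by apply/seteqP; split => y; rewrite /cball /closed_ball_ /= distrC.
apply: bounded_closed_compact; last exact: closed_closed_ball_.
exists (r + `|x0|); split; first exact: num_real.
move=> M rM y; rewrite /closed_ball_ /= => yr.
by rewrite -(subKr x0 y); apply: le_trans (ler_normB _ _) _; lra.
Qed.

(** Quartering a triangle of nonzero circulation again and again gives nested
    triangles of size D / 2^n and circulation at least eta / 4^n. They
    accumulate at a point of the ball, where this contradicts the bound o(s^2)
    of [circulation_small] for a triangle of size s. *)
Lemma goursat x0 r t : cball x0 r `<=` A -> vertices_in (cball x0 r) t ->
  circulation t = 0.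
Proof.
move=> BA tB; apply/eqP; apply/negPn/negP => T0.
pose eta := `|circulation t|.
have eta0 : 0 < eta by rewrite normr_gt0.
pose D := `|t.1.2 - t.1.1| + `|t.2 - t.1.2| + `|t.1.1 - t.2|.
have D0 : 0 <= D by rewrite !addr_ge0.
(* Along the sequence the first vertices move by at most D / 2^n, so the n-th
   triangle is within 2 D / 2^n of any limit point z. *)
pose good n u := [/\ vertices_in (cball x0 r) u, sides_le (D / 2 ^+ n) u &
  eta / 4 ^+ n <= `|circulation u|].
have step n u : good n u ->
    exists u', good n.+1 u' /\ `|u'.1.1 - u.1.1| <= D / 2 ^+ n.
  move=> [uB uD uT].
  have [u' [u1 u2 u3 u4]] := circulation_quarter (@cball_convex x0 r) BA uB uD
    uT.
  exists u'; split => //; split => //.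
    by move: u2; rewrite exprSr invfM mulrA.
  by move: u3; rewrite exprSr invfM mulrA.
pose next n u := match pselect (good n u) with
  | left h => sval (cid (step n u h)) | right _ => u end.
pose u := fix u n := if n is m.+1 then next m (u m) else t.
have ugood n : good n (u n).
  elim: n => [|n IH] /=.
    rewrite /good !expr0 !divr1; split => //.
    exact: sum3_ge.
  by rewrite /next; case: pselect => // h; have [] := svalP (cid (step n _ h)).
have unext n : `|(u n.+1).1.1 - (u n).1.1| <= D / 2 ^+ n.
  rewrite /= /next; case: pselect => [h|]; last by have := ugood n.
  by have [] := svalP (cid (step n _ h)).
have ucauchy n k : `|(u (n + k)%N).1.1 - (u n).1.1| <=
  2 * (D / 2 ^+ n) - 2 * (D / 2 ^+ (n + k)).
  elim: k => [|k IH]; first by rewrite addn0 !subrr normr0.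
  have := ler_normD ((u (n + k.+1)%N).1.1 - (u (n + k)%N).1.1)
    ((u (n + k)%N).1.1 - (u n).1.1).
  rewrite subrKA => /le_trans; apply; rewrite addnS.
  have := unext (n + k)%N; rewrite exprSr invfM mulrA; lra.
move: u ugood ucauchy {unext} => u ugood ucauchy.
have [z [zB zcl]] : cball x0 r `&` cluster ((fun n => (u n).1.1) @ \oo) !=set0.
  apply: (@cball_compact x0 r); exists 0%N => // n _ /=.
  by have [[]] := ugood n.
have near_z n : `|(u n).1.1 - z| <= 2 * (D / 2 ^+ n).
  apply/ler_addgt0Pr => e e0.
  pose S := [set x | exists2 m, (n <= m)%N & (u m).1.1 = x].
  have FS : ((fun n => (u n).1.1) @ \oo) S by exists n => // m /= nm; exists m.
  have [_ [[m nm <-] mz]] := zcl S (ball z e) FS (nbhsx_ballx z e e0).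
  move: mz; rewrite -ball_normE /= distrC => mz.
  have := ucauchy n (m - n)%N; rewrite subnKC // => h.
  have := ler_normD ((u n).1.1 - (u m).1.1) ((u m).1.1 - z); rewrite subrKA.
  have : 0 <= D / 2 ^+ m by rewrite divr_ge0 // exprn_ge0.
  move: h; rewrite distrC; lra.
pose e := eta / (D ^+ 2 + 1).
have D1 : 0 < D ^+ 2 + 1 by rewrite ltr_wpDl ?sqr_ge0.
have e0 : 0 < e by exact: divr_gt0.
have [d d0 dP] := circulation_small (BA _ zB) e0.
have [n nd] : exists n, 4 * (D / 2 ^+ n) < d.
  exists (Num.bound (4 * D / d)).
  have := archi_boundP (divr_ge0 (mulr_ge0 (ler0n R 4) D0) (ltW d0)).
  move: (Num.bound _) => n nP.
  have n2 : n%:R <= 2 ^+ n :> R by rewrite -natrX ler_nat ltnW // ltn_expl.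
  rewrite mulrA ltr_pdivrMr ?exprn_gt0 // [d * _]mulrC -ltr_pdivrMr //.
  exact: lt_le_trans nP n2.
have [[u1 u2 u3] uD uT] := ugood n.
have := dP _ _ _ uD (near_z n) nd => /(_ (And3 (BA _ u1) (BA _ u2) (BA _ u3))).
move=> /(le_trans uT); rewrite leNgt => /negP; apply.
rewrite expr_div_n -exprM mulnC exprM (_ : 2 ^+ 2 = 4 :> R); last by ring.
rewrite mulrA ltr_pM2r ?invr_gt0 ?exprn_gt0 // /e mulrAC ltr_pdivrMr //.
by rewrite ltr_pM2l // ltrDl.
Qed.

(** Integrating from the centre gives a primitive: by [goursat] its increment
    from y to y + h is the integral along this short segment. *)
Lemma ball_primitive x0 r : 0 < r -> cball x0 r `<=` A ->
  exists f : E -> R, forall y, ball x0 r y -> is_diff y f (covec (th y)).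
Proof.
move=> r0 BA; exists (I x0) => y; rewrite -ball_normE /= distrC => yr.
have Bx0 : cball x0 r x0 by rewrite /cball /= subrr normr0 ltW.
have By : cball x0 r y by rewrite /cball /= ltW.
apply/covec_is_diffP => e e0.
have eN : 0 < e / (N%:R + 1) by rewrite divr_gt0 // ltr_wpDl.
have [d d0 dH] := closed_at_continuous (thA (BA _ By)) eN.
exists (Num.min d (r - `|y - x0|)) => [|h]; first by rewrite lt_min d0 subr_gt0.
rewrite lt_min => /andP[hd hr].
have Byh : cball x0 r (y + h).
  rewrite /cball /= addrAC; apply: le_trans (ler_normD _ _) _; lra.
have -> : I x0 (y + h) - I x0 y = I y (y + h).
  have := @goursat x0 r (x0, y, y + h) BA (And3 Bx0 By Byh).
  rewrite /circulation /= (seg_int_opp cA thA (BA _ Bx0) (BA _ Byh)).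
  by move: (I _ _) (I _ _) (I _ _) => u v w; lra.
have E1 : y + h - y = h by rewrite addrAC subrr add0r.
have := @seg_int_le _ _ A th cA thA y (y + h) (covec (th y)) (fun=> th y)
  (e / (N%:R + 1)) (BA _ By) (BA _ Byh).
rewrite -covecB E1 => B; apply: le_trans (B _ _) _.
- move=> t _; apply/covec_is_diffP => e1 e10; exists 1 => // k _.
  by rewrite covecD [_ + covec _ k]addrC addrK subrr normr0 mulr_ge0 // ltW.
- move=> t /andP[t0 t1]; apply: dH; rewrite normrZ ger0_norm //.
  by apply: le_lt_trans hd; rewrite ler_piMl.
- rewrite ler_wpM2r // mulrCA ler_piMr ?ltW // ltr_pdivrMr ?ltr_wpDl // mul1r.
  by rewrite ltrDl.
Qed.

End Goursat.

(** * Gluing local primitives *)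

Section GlobalPrimitive.
Variables (R : realType) (V : normedModType R) (X : set V) (al : V -> V -> R).
Hypothesis cX : segment_convex X.
Hypothesis loc : forall x, X x -> exists2 r : R, 0 < r &
  exists f : V -> R, forall y, ball x r y -> is_diff y f (al y).

(** The neighbourhood of radius d of the segment from x0 to x. It is convex, as
    is its intersection with another such neighbourhood or with a ball; there
    two primitives of the same form differ by a constant. *)
Definition tube (x0 x : V) (d : R) : set V :=
  [set z | exists2 t : R, 0 <= t <= 1 & `|z - (x0 + t *: (x - x0))| < d].

Definition tube_primitive (x0 x : V) (f : V -> R) : Prop :=
  exists2 d : R, 0 < d & forall z, tube x0 x d z -> is_diff z f (al z).

Lemma tube_convex x0 x d : segment_convex (tube x0 x d).
Proof.
move=> y z s [t /andP[t0 t1] yt] [u /andP[u0 u1] zu] /andP[s0 s1].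
exists (t + s * (u - t)); first by apply/andP; split; nra.
pose p := x0 + t *: (x - x0); pose q := x0 + u *: (x - x0).
have -> : x0 + (t + s * (u - t)) *: (x - x0) = p + s *: (q - p).
  by rewrite /q /p opprD addrACA subrr add0r -scalerBl scalerA scalerDl addrA.
have -> : y + s *: (z - y) - (p + s *: (q - p)) = (1 - s) *: (y - p)
  + s *: (z - q).
  rewrite conv_combE opprD addrACA -scalerBr.
  by congr (_ + _ *: _); rewrite !opprD !opprK addrACA.
apply: le_lt_trans (ler_normD _ _) _; rewrite !normrZ !ger0_norm ?subr_ge0 //.
exact: convex_comb_lt.
Qed.

Lemma tube_open x0 x d z : tube x0 x d z ->
  exists2 r : R, 0 < r & ball z r `<=` tube x0 x d.
Proof.
move=> [t tI zt]; exists (d - `|z - (x0 + t *: (x - x0))|);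
  first by rewrite subr_gt0.
move=> y; rewrite -ball_normE /= distrC => yz; exists t => //.
by rewrite -(subrKA z); apply: le_lt_trans (ler_normD _ _) _; rewrite -ltrBrDr.
Qed.

Lemma tube_start x0 x d : 0 < d -> tube x0 x d x0.
Proof. by move=> d0; exists 0; rewrite ?lexx ?ler01 // scale0r addr0 subrr
  normr0. Qed.

Lemma tube_end x0 x d y : `|y - x| < d -> tube x0 x d y.
Proof. by move=> d0; exists 1; rewrite ?lexx ?ler01 // scale1r [x0 +
  _]addrC subrK. Qed.

(** On the convex set where A and B meet the two primitives differ by a
    constant. Shifting g by this constant makes them agree. *)
Lemma glue_primitive (A B : set V) f g p : segment_convex A ->
    segment_convex B ->
  (forall z, A z -> exists2 r : R, 0 < r & ball z r `<=` A) ->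
  (forall z, B z -> exists2 r : R, 0 < r & ball z r `<=` B) ->
  (forall z, A z -> is_diff z f (al z)) ->
  (forall z, B z -> is_diff z g (al z)) -> A p -> B p ->
  exists h, forall z, (A `|` B) z -> is_diff z h (al z).
Proof.
move=> cA cB oA oB fA gB Ap Bp.
pose c := f p - g p.
pose h z := if `[< A z >] then f z else g z + c.
have hA z : A z -> h z = f z by move=> Az; rewrite /h asboolT.
have hB z : B z -> h z = g z + c.
  move=> Bz; rewrite /h; case: asboolP => // Az.
  have cAB : segment_convex (A `&` B).
    by move=> u v t [Au Bu] [Av Bv] tI; split; [exact: cA|exact: cB].
  have := same_primitive cAB (fun z Hz => fA z Hz.1) (fun z Hz => gB z Hz.2)
    (conj Ap Bp) (conj Az Bz).
  rewrite /c; lra.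
exists h => z [Az|Bz].
  have [r r0 rA] := oA z Az.
  by apply: (near_eq_is_diff r0 _ (fA z Az)) => y /rA/hA.
have [r r0 rB] := oB z Bz.
apply: (@near_eq_is_diff _ _ _ (g + cst c) _ _ _ _ r0) => [y /rB/hB //|].
exact: (is_diff_eq (is_diffD (gB z Bz) (is_diff_cst c z)) (addr0 _)).
Qed.

(** Let s be the supremum of the t such that the segment from x0 to
    x0 + t (x - x0) has a tube with a primitive. Near the point of parameter s
    there is a primitive on a ball; gluing it to a primitive on a tube that ends
    in this ball reaches beyond s, unless s = 1. *)
Lemma tube_primitive_exists x0 x : X x0 -> X x -> exists f,
    tube_primitive x0 x f.
Proof.
move=> X0 Xx.
pose ga (t : R) := x0 + t *: (x - x0).
pose S := [set t : R | 0 <= t <= 1 /\ exists f, tube_primitive x0 (ga t) f].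
have gaB t u : ga t - ga u = (t - u) *: (x - x0).
  by rewrite /ga opprD addrACA subrr add0r scalerBl.
have gax t : ga t - x0 = t *: (x - x0) by rewrite /ga addrC addKr.
have S0 : S 0.
  split; first by rewrite lexx ler01.
  have [r r0 [f fP]] := loc X0; exists f; exists r => // z [t _].
  rewrite /ga scale0r addr0 subrr scaler0 addr0 distrC => zr; apply: fP.
  by rewrite -ball_normE.
have S1 t : S t -> t <= 1 by move=> [/andP[]].
have hS : has_sup S by split; [exists 0|exists 1 => t /S1].
pose s := sup S.
have s0 : 0 <= s by exact: ub_le_sup hS.2 0 S0.
have s1 : s <= 1 by apply: ge_sup; [exists 0|move=> t /S1].
have Xs : X (ga s) by apply: cX => //; rewrite s0.
have [r r0 [g gP]] := loc Xs.
(* Parameters within eta of s give points at distance less than r / 2 from the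
   point of parameter s. *)
pose K := 2 * (`|x - x0| + 1).
have K0 : 0 < K by rewrite mulr_gt0 // ltr_wpDl.
pose eta := r / K.
have eta0 : 0 < eta by exact: divr_gt0.
have near t : `|t - s| < eta -> `|ga t - ga s| < r / 2.
  rewrite gaB normrZ /eta ltr_pdivlMr // => h.
  have : `|t - s| * `|x - x0| <= `|t - s| * (`|x - x0| + 1)
    by rewrite ler_wpM2l // lerDl.
  by move: h; rewrite /K; lra.
(* A tube ending at a parameter t just before s carries a primitive, and it is
   extended to the tube ending at a parameter t' beyond s, or at t' = 1. *)
have [t [tI [f [d d0 fP]]] ts] := sup_adherent eta0 hS.
have ts' : t <= s by exact: ub_le_sup hS.2 _
  (conj tI (ex_intro _ f (ex_intro2 _ _ d d0 fP))).
pose t' := Num.min 1 (s + eta / 2).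
have t'1 : t' <= 1 by rewrite ge_min lexx.
have tt' : t <= t' by rewrite le_min (le_trans ts') //= (le_trans ts') // lerDl
  divr_ge0 // ltW.
have t's : t' <= s + eta / 2 by rewrite ge_min lexx orbT.
move/andP: tI => [t0 t1].
have t'0 : 0 <= t' by exact: le_trans t0 tt'.
have tnear u : t <= u -> u <= t' -> `|u - s| < eta.
  move=> tu ut; rewrite ltr_norml; apply/andP; split.
    by rewrite ltrBrDl; apply: lt_le_trans tu; exact: ts.
  rewrite ltrBlDl; apply: le_lt_trans ut _; apply: le_lt_trans t's _.
  by rewrite ltrD2l ltr_pdivrMr // ltr_pMr // ltr1n.
have St' : S t'.
  split; first by rewrite t'0.
  have At : tube x0 (ga t) d (ga t) by apply: tube_end; rewrite subrr normr0.
  have Bt : ball (ga s) r (ga t).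
    rewrite -ball_normE /= distrC; apply: lt_trans (near t _) _.
      by apply: tnear.
    by rewrite ltr_pdivrMr // ltr_pMr // ltr1n.
  have [h hP] := glue_primitive (@tube_convex x0 (ga t) d)
    (@ball_convex _ _ (ga s) r) (@tube_open x0 (ga t) d)
      (@ball_subball _ _ (ga s) r) fP gP At Bt.
  exists h; exists (Num.min d (r / 2)); first by rewrite lt_min d0 divr_gt0.
  move=> z [u /andP[u0 u1]]; rewrite lt_min => /andP[zd zr]; apply: hP.
  have E v : x0 + u *: (ga v - x0) = ga (u * v).
    by rewrite gax scalerA.
  rewrite E in zd zr.
  (* The part of the new tube around parameters up to t lies in the old tube,
     the rest in the ball. *)
  have [ut|tu] := lerP (u * t') t.
    left; have [tz|tz] := eqVneq t 0.
      exists 0; first by rewrite lexx ler01.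
      have ut0 : u * t' = 0 by apply/eqP; rewrite eq_le -{1}tz ut mulr_ge0.
      by move: zd; rewrite ut0 /ga !scale0r.
    have tp : 0 < t by rewrite lt_neqAle eq_sym tz.
    exists (u * t' / t); first by rewrite divr_ge0 ?mulr_ge0 //= ler_pdivrMr //
      mul1r.
    have -> : x0 + (u * t' / t) *: (ga t - x0) = ga (u * t').
      by rewrite gax scalerA divfK.
    exact: zd.
  right; rewrite -ball_normE /= distrC -(subrKA (ga (u * t'))).
  apply: le_lt_trans (ler_normD _ _) _; rewrite [r]splitr; apply: ltrD => //.
  by apply: near; apply: tnear; [exact: ltW|rewrite ler_piMl].
have : t' <= s by exact: ub_le_sup hS.2 _ St'.
rewrite leNgt lt_min => /negP ns.
have t'E : t' = 1.
  apply/eqP; rewrite eq_le t'1 /= leNgt; apply/negP => t'lt1; apply: ns.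
  have : s + eta / 2 < 1 by move: t'lt1; rewrite /t' gt_min ltxx.
  by move=> h; have h' : 0 < eta / 2 by [exact: divr_gt0];
    rewrite ltrDl h' andbT; lra.
by case: St' => _ [h hP]; exists h; move: hP; rewrite t'E /ga scale1r [x0 +
  _]addrC subrK.
Qed.

(** The value at x is the increment from x0 to x of a primitive on a tube around
    this segment. For y near x the tubes to x and to y meet in a convex set that
    contains x0 and y, so one primitive serves for both increments. *)
Lemma global_primitive x0 : X x0 ->
  (forall x, X x -> exists2 r : R, 0 < r & ball x r `<=` X) ->
  exists F : V -> R, forall x, X x -> is_diff x F (al x).
Proof.
move=> X0 oX.
pose f x := get (tube_primitive x0 x).
have fP x : X x -> tube_primitive x0 x (f x).
  by move=> Xx; have [g gP] := tube_primitive_exists X0 Xx;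
    exact: (getPex (ex_intro _ g gP)).
exists (fun x => f x x - f x x0) => x Xx.
have [d d0 dP] := fP x Xx.
have [r r0 rX] := oX x Xx.
pose e := Num.min d r.
have e0 : 0 < e by rewrite lt_min d0.
have fx : is_diff x (f x) (al x).
  by apply: dP; apply: tube_end; rewrite subrr normr0.
apply: (@near_eq_is_diff _ _ _ (f x - cst (f x x0)) _ _ _ _ e0); last first.
  exact: (is_diff_eq (is_diffB fx (is_diff_cst _ x)) (subr0 _)).
move=> y; rewrite -ball_normE /= distrC lt_min => /andP[yd yr].
have Xy : X y by apply: rX; rewrite -ball_normE /= distrC.
have [d' d'0 d'P] := fP y Xy.
have cT : segment_convex (tube x0 x d `&` tube x0 y d').
  by move=> u v t [Au Bu] [Av Bv] tI; split; exact: tube_convex.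
apply: (same_primitive cT (fun z Hz => dP z Hz.1) (fun z Hz => d'P z Hz.2)).
  by split; exact: tube_start.
by split; apply: tube_end => //; rewrite subrr normr0.
Qed.

End GlobalPrimitive.

Lemma closed_form_primitive (R : realType) (N : nat) (X : set 'rV[R]_N)
    (th : 'rV[R]_N -> 'cV[R]_N) (x0 : 'rV[R]_N) : segment_convex X -> X x0 ->
  (forall x, X x -> exists2 r : R, 0 < r & ball x r `<=` X) ->
  (forall x, X x -> closed_at th x) ->
  exists F : 'rV[R]_N -> R, forall x, X x -> is_diff x F (covec (th x)).
Proof.
move=> cX X0 oX thX.
apply: (@global_primitive _ _ X (fun x => covec (th x)) cX _ x0 X0 oX) => x Xx.
have [r r0 rX] := oX x Xx.
have r20 : 0 < r / 2 by exact: divr_gt0.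
have cb : cball x (r / 2) `<=` X.
  move=> y; rewrite /cball /= => yx; apply: rX; rewrite -ball_normE /= distrC.
  by apply: le_lt_trans yx _; rewrite ltr_pdivrMr // ltr_pMr // ltr1n.
by exists (r / 2) => //; exact: (ball_primitive cX thX r20 cb).
Qed.

(** * The mean value property in a half-plane *)

Definition point2 (R : realType) (x y : R) : 'rV[R]_2 :=
    \row_j (if j == 0 then x else y).

Lemma point2DZ (R : realType) (x y a b k : R) : point2 x y + k *: point2 a b =
    point2 (x + k * a) (y + k * b).
Proof. by apply/rowP => j; rewrite !mxE; case: eqP. Qed.

Lemma point2_fst (R : realType) (x y : R) : point2 x y 0 0 = x.
Proof. by rewrite mxE. Qed.

Lemma point2_snd (R : realType) (x y : R) : point2 x y 0 1 = y.
Proof. by rewrite mxE. Qed.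

Lemma covec_point2 (R : realType) (M : 'cV[R]_2) (x y : R) :
    covec M (point2 x y) = x * M 0 0 + y * M 1 0.
Proof. by rewrite covecE big_ord_recl big_ord1 (_ : lift _ _ =
  1) ?point2_fst ?point2_snd //; exact: val_inj. Qed.

Definition half_plane (R : realType) (rho : R) : set 'rV[R]_2 :=
    [set w | w 0 0 < rho].

Lemma half_plane_convex (R : realType) (rho : R) :
    segment_convex (half_plane rho).
Proof.
move=> x y t; rewrite /half_plane /= => xr yr /andP[t0 t1]; rewrite !mxE.
by have := convex_comb_lt t0 t1 xr yr; lra.
Qed.

Lemma half_plane_open (R : realType) (rho : R) x : half_plane rho x ->
  exists2 r : R, 0 < r & ball x r `<=` half_plane rho.
Proof.
rewrite /half_plane /= => xr; exists (rho - x 0 0); first by rewrite subr_gt0.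
move=> y; rewrite -ball_normE /= => xy.
have := le_lt_trans (coord_le_norm (x - y) 0 0) xy;
  rewrite !mxE ltr_norml => /andP[]; lra.
Qed.

(** The form v dx + u dy is the imaginary part of (u + i v) d(x + i y), and
    u_x = v_y is one of the Cauchy-Riemann equations. *)
Lemma closed_at_plane (R : realType) (u v : 'rV[R]_2 -> R) (w : 'rV[R]_2)
    (du dv : 'cV[R]_2) : is_diff w u (covec du) -> is_diff w v (covec dv) ->
  du 0 0 = dv 1 0 -> closed_at (fun z => (point2 (v z) (u z))^T) w.
Proof.
move=> /covec_is_diffP uP /covec_is_diffP vP e.
exists (\matrix_(i, j) if j == 0 then dv i 0 else du i 0).
  have two (j : 'I_2) : j = 0 \/ j = 1.
    by case: j => [[|[|]]] // p; [left|right]; exact: val_inj.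
  by apply/matrixP => i j; rewrite !mxE; case: (two i) => ->;
    case: (two j) => -> //=.
move=> a a0; have [d1 d10 H1] := uP a a0; have [d2 d20 H2] := vP a a0.
exists (Num.min d1 d2) => [|h]; first by rewrite lt_min d10.
rewrite lt_min => /andP[/H1 h1 /H2 h2].
rewrite [leLHS]/Num.Def.normr /= mx_normrE; apply/bigmax_leP;
  split => [|[i j] _ /=].
  by rewrite mulr_ge0 // ltW.
rewrite (ord1 j) !mxE; case: eqP => i0.
  rewrite (_ : \sum__ _ = covec dv h) //.
  by rewrite covecE; apply: eq_bigr => k _; rewrite mxE i0.
rewrite (_ : \sum__ _ = covec du h) //.
by rewrite covecE; apply: eq_bigr => k _; rewrite mxE; case: eqP i0.
Qed.

(** Let F be a primitive of v dx + u dy. Then F(x, T) - F(x, 0) is the integral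
    of u over a vertical segment of height T. Its derivative in x is
    v(x, T) - v(x, 0) = 0, so it is constant. It is arbitrarily small because u
    is, hence it is 0, and the mean value theorem gives a zero of u.

    With (x, y) = log zeta this is the mean value property on circles around
    zeta = 0 for the real part of a function that vanishes there. *)
Lemma periodic_mean_zero (R : realType) (rho T : R) (u v : 'rV[R]_2 -> R) :
  0 < T ->
  (forall w, half_plane rho w -> exists du dv : 'cV[R]_2,
     [/\ is_diff w u (covec du), is_diff w v (covec dv) & du 0 0 = dv 1 0]) ->
  (forall x, x < rho -> v (point2 x T) = v (point2 x 0)) ->
  (forall e : R, 0 < e ->
     exists2 a, a < rho & forall y, `|u (point2 a y)| <= e) ->
  forall x, x < rho -> exists y, u (point2 x y) = 0.
Proof.
move=> T0 uvP vT u0.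
have [F FP] : exists F : 'rV[R]_2 -> R, forall w, half_plane rho w ->
    is_diff w F (covec (point2 (v w) (u w))^T).
  have X0 : half_plane rho (point2 (rho - 1) 0)
    by rewrite /half_plane /= point2_fst; lra.
  apply: (closed_form_primitive (@half_plane_convex R rho) X0
    (@half_plane_open R rho)).
  by move=> w /uvP[du [dv [h1 h2 h3]]]; exact: closed_at_plane h1 h2 h3.
pose C x := F (point2 x T) - F (point2 x 0).
have CE x1 x2 : x1 < rho -> x2 < rho -> C x2 = C x1.
  move=> h1 h2; pose d := point2 (x2 - x1) 0.
  pose G := (fun r : R => F (point2 x1 T + r *: d)) - (fun r :
    R => F (point2 x1 0 + r *: d)).
  have : `|G 1 - G 0| <= 0.
    apply: (is_derive_le (f := fun=> 0)) => t tI; last by rewrite normr0.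
    have tr : x1 + t * (x2 - x1) < rho.
      by move: tI => /andP[t0 t1]; have := convex_comb_lt t0 t1 h1 h2; lra.
    have hT : half_plane rho (point2 x1 T + t *: d)
      by rewrite point2DZ /half_plane /= point2_fst.
    have h0 : half_plane rho (point2 x1 0 + t *: d)
      by rewrite point2DZ /half_plane /= point2_fst.
    have := is_deriveB (is_diff_line (FP _ hT)) (is_diff_line (FP _ h0)).
    rewrite !covec_point2 !mxE /= !point2DZ !mulr0 !addr0 !mul0r (vT _ tr)
      subrr; exact.
  rewrite normr_le0 subr_eq0 /G -![(_ - _ : _ ->
    _) _]/(_ - _) !point2DZ !mul1r !mul0r !addr0.
  by rewrite [x1 + _]addrC subrK => /eqP.
have CM x : x < rho -> exists y, C x = T * u (point2 x y).
  move=> xr.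
  have [|t _ e] := @MVT_line R _ F (fun w => covec (point2 (v w) (u w))^T)
    (point2 x 0) (point2 0 T).
    by move=> t _; apply: FP; rewrite point2DZ /half_plane /= point2_fst mulr0
      addr0.
  exists (t * T); move: e; rewrite covec_point2 !mxE /= mul0r add0r point2DZ
    mulr0 addr0 add0r.
  by rewrite -[point2 0 T]scale1r point2DZ mulr0 addr0 add0r mul1r.
move=> x xr; have [y Cy] := CM x xr; exists y.
apply/eqP; rewrite -normr_le0; apply/ler_addgt0Pr => e e0; rewrite add0r.
have [a ar ua] := u0 e e0; have [y' Cy'] := CM a ar; have := ua y'.
suff -> : u (point2 a y') = u (point2 x y) by [].
by apply: (mulfI (lt0r_neq0 T0)); rewrite -Cy -Cy'; exact: CE.
Qed.

(** * Second-order expansions *)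

Lemma quad_is_derive (R : realType) (c k t : R) :
  is_derive t 1 (fun r : R => c * r + k * r ^+ 2) (c + 2 * k * t).
Proof.
have E : (fun r : R => c * r + k * r ^+ 2) = (c \*: (@id R))
  + (k \*: ((@id R) ^+ 2)).
  apply/funext => r; rewrite -![(_ + _ : _ -> _) _]/(_ + _) /=.
  by rewrite expr2.
rewrite E.
have h1 : is_derive t 1 (c \*: (@id R)) (c *: 1) by exact: is_deriveZ.
have h2 : is_derive t 1 ((@id R) ^+ 2) ((2%:R * t ^+ 1) *: 1)
  by exact: is_deriveX.
have h3 : is_derive t 1 (k \*: ((@id R) ^+ 2)) (k *: ((2%:R * t ^+ 1) *: 1))
  by exact: is_deriveZ.
apply: (is_derive_eq (is_deriveD h1 h3)).
by rewrite -![_ *: _]/(_ * _) expr1; ring.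
Qed.

(** The second-order expansion of f at x follows from the first-order expansion
    of its gradient at x alone, by the mean value inequality for f minus its
    quadratic approximation on the segment from x to x + h. *)
Lemma taylor2 (R : realType) (N : nat) (f : 'rV[R]_N -> R)
    (be : 'rV[R]_N -> 'cV[R]_N)
    (x : 'rV[R]_N) (H : 'M[R]_N) (r : R) : 0 < r ->
  (forall y, ball x r y -> is_diff y f (covec (be y))) ->
  (forall e : R, 0 < e -> exists2 d : R, 0 < d & forall h : 'rV[R]_N,
      `|h| < d -> `|be (x + h) - be x - (h *m H)^T| <= e * `|h|) ->
  forall e : R, 0 < e -> exists2 d : R, 0 < d & forall h : 'rV[R]_N, `|h| < d ->
    `|f (x + h) - f x - covec (be x) h - 2^-1 * covec (h *m H)^T h| <=
      e * `|h| ^+ 2.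
Proof.
move=> r0 fP beP e e0.
have eN : 0 < e / (N%:R + 1) by rewrite divr_gt0 // ltr_wpDl.
have [d d0 dH] := beP _ eN.
exists (Num.min d r) => [|h]; first by rewrite lt_min d0.
rewrite lt_min => /andP[hd hr].
pose g t := covec (be x) h * t + 2^-1 * covec (h *m H)^T h * t ^+ 2.
pose G := (fun t : R => f (x + t *: h)) - g.
have -> : f (x + h) - f x - covec (be x) h - 2^-1 * covec (h *m H)^T h =
  G 1 - G 0.
  rewrite /G /g -![(_ - _ : _ -> _) _]/(_ - _) scale1r scale0r addr0; ring.
have gD (t : R) : is_derive t 1 g (covec (be x) h + t * covec (h *m H)^T h).
  by apply: (is_derive_eq (quad_is_derive _ _ _)); field.
have tI (t : R) : 0 <= t <= 1 -> `|t *: h| <= `|h|.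
  by move=> /andP[t0 t1]; rewrite normrZ ger0_norm // ler_piMl.
apply: (is_derive_le (f := fun t => covec (be (x + t *: h)) h -
  (covec (be x) h + t * covec (h *m H)^T h))) => t t01.
  apply: is_deriveB (gD t); apply: is_diff_line; apply: fP.
  by rewrite -ball_normE /= opprD addrA subrr sub0r normrN;
    apply: le_lt_trans (tI t t01) hr.
have -> : covec (be (x + t *: h)) h - (covec (be x) h + t * covec (h *m H)^T h)
  =
   covec (be (x + t *: h) - be x - ((t *: h) *m H)^T) h.
  by rewrite -scalemxAl linearZ /= /covec !mulmxBr -scalemxAr !mxE; ring.
apply: le_trans (covec_le _ _) _.
have B := dH _ (le_lt_trans (tI t t01) hd).
rewrite expr2 mulrA ler_wpM2r //.
apply: (@le_trans _ _ (N%:R * (e / (N%:R + 1) * `|h|))).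
  by rewrite ler_wpM2l //; apply: le_trans B _; rewrite ler_wpM2l ?tI // ltW.
rewrite mulrA ler_wpM2r // mulrCA ler_piMr ?ltW // ltr_pdivrMr ?ltr_wpDl //
  mul1r.
by rewrite ltrDl.
Qed.

(** * The maximum principle along a complex line *)

Lemma Jmx_mul (R : realType) (n : nat) : Jmx R n *m Jmx R n = - 1%:M.
Proof.
rewrite /Jmx mulmx_block !mul0mx !mulmx0 !mul1mx !mulmx1 !addr0 !add0r.
by rewrite [in RHS]scalar_mx_block opp_block_mx !oppr0.
Qed.

Lemma mulJJ (R : realType) (m n : nat) (v : 'M[R]_(m, n + n)) :
    v *m Jmx R n *m Jmx R n = - v.
Proof. by rewrite -mulmxA Jmx_mul mulmxN mulmx1. Qed.

(** A positive quadratic form has a positive minimum on the unit sphere, which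
    is compact. *)
Lemma posdef_coercive (R : realType) (N : nat) (S : 'M[R]_N) : S^T = S ->
  (forall v : 'rV[R]_N, v != 0 -> 0 < covec (S *m v^T) v) ->
  exists2 c : R, 0 < c & forall v : 'rV[R]_N, c * `|v| ^+ 2 <=
    covec (S *m v^T) v.
Proof.
move=> Ss S0.
pose Sp := [set v : 'rV[R]_N | `|v| = 1].
have scal k v : covec (S *m (k *: v)^T) (k *: v) = k ^+ 2 * covec (S *m v^T) v.
  by rewrite covecZ linearZ /= -scalemxAr /covec -scalemxAr mxE; ring.
have [[v1 v1S]|noS] := pselect (Sp !=set0); last first.
  exists 1 => // v; have [->|vN] := eqVneq v 0.
    by rewrite normr0 expr0n /= mulr0 /covec mul0mx mxE.
  exfalso; apply: noS; exists (`|v|^-1 *: v); rewrite /Sp /= normrZ normfV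
    normr_id mulVf //.
  by rewrite normr_eq0.
have cq : continuous (fun y => covec 0 y + 2^-1 * covec (S *m (y - 0)^T)
  (y - 0)).
  move=> y; apply: differentiable_continuous.
  exact: (@ex_diff _ _ _ _ _ _ _ (quadratic_is_diff 0 0 y Ss)).
have cS : compact Sp.
  have SpB : Sp `<=` cball 0 1 by move=> v; rewrite /Sp /cball /= subr0 => ->.
  apply: subclosed_compact SpB; last exact: cball_compact.
  apply: (@closed_comp _ _ (fun v : 'rV[R]_N => `|v|) [set 1]);
    last exact: closed_eq.
  by move=> v _; exact: norm_continuous.
have [c cS' cmin] := EVT_min_rV (ex_intro _ v1 v1S) cS
  (continuous_subspaceT cq).
have c1 : `|c| = 1 by move: cS'; rewrite inE.
have cn0 : c != 0 by rewrite -normr_gt0 c1.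
exists (covec (S *m c^T) c) => [|v]; first exact: S0.
have [->|vN] := eqVneq v 0.
  by rewrite normr0 expr0n /= mulr0 /covec mul0mx mxE.
have v0 : 0 < `|v| by rewrite normr_gt0.
have vS : (`|v|^-1 *: v) \in Sp.
  by rewrite inE /Sp /= normrZ normfV normr_id mulVf // gt_eqF.
have qE v' : covec 0 v' + 2^-1 * covec (S *m (v' - 0)^T) (v' - 0) =
  2^-1 * covec (S *m v'^T) v'.
  by rewrite subr0 /covec mulmx0 mxE add0r.
have := cmin _ vS; rewrite !qE ler_pM2l ?invr_gt0 // scal exprVn ler_pdivlMl
  ?exprn_gt0 // mulrC; exact.
Qed.

Lemma covec_coordE (R : realType) (N : nat) (k : 'I_N) (h : 'rV[R]_N) :
  covec (delta_mx k 0) h = h 0 k.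
Proof.
rewrite covecE (bigD1 k) //= big1 => [|i /negPf ik];
  rewrite mxE ?eqxx ?mulr1 ?addr0 //.
by rewrite ik mulr0.
Qed.

Lemma coord_is_diff (R : realType) (N : nat) (k : 'I_N) (w : 'rV[R]_N) :
  is_diff w (fun z : 'rV[R]_N => z 0 k) (covec (delta_mx k 0)).
Proof.
apply/covec_is_diffP => a a0; exists 1 => // h _.
by rewrite covec_coordE mxE [_ + h _ _]addrC addrK subrr normr0 mulr_ge0 // ltW.
Qed.

Section HolomorphicCurve.
Variables (R : realType) (m : nat) (p e : 'rV[R]_(m + m)).
Hypothesis e0 : e != 0.
Local Notation J := (Jmx R m).

(** The complex line p + zeta e in the coordinate w = (x, y) with zeta = exp
    (x + i y). The point p is sent to x = - infinity, and the circles around it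
    become vertical segments of height 2 pi. *)
Definition exp_curve (w : 'rV[R]_2) : 'rV[R]_(m + m) :=
  p + (expR (w 0 0) * cos (w 0 1)) *: e + (expR (w 0 0) * sin (w 0 1))
    *: (e *m J).

Lemma is_diff_of_derive (f : R -> R) (x d : R) : is_derive x 1 f d ->
    is_diff x f (fun h => h * d).
Proof.
move=> [fd dE]; apply: DiffDef; first exact/derivable1_diffP.
rewrite diff1E; last exact/derivable1_diffP.
by apply/funext => h; rewrite derive1E dE.
Qed.

Lemma is_diff_vecZ (V W : normedModType R) (f df : V -> R) (x : V) (v : W) :
  is_diff x f df -> is_diff x (fun z => f z *: v) (fun h => df h *: v).
Proof.
move=> [fd dE]; apply: DiffDef; first exact: differentiableZl.
by rewrite diffZl // dE.
Qed.

Lemma exp_curveE w : exp_curve w - p =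
  expR (w 0 0) *: (cos (w 0 1) *: e + sin (w 0 1) *: (e *m J)).
Proof. by rewrite /exp_curve addrAC [p + _ - p]addrAC subrr add0r scalerDr
  !scalerA. Qed.

(** As d zeta = zeta d(x + i y), the partial derivatives of zeta e are zeta e
    itself and i zeta e. *)
Lemma exp_curve_diff w :
  is_diff w exp_curve (fun h => h 0 0 *: (exp_curve w - p)
                              + h 0 1 *: ((exp_curve w - p) *m J)).
Proof.
have c0 := coord_is_diff 0 w; have c1 := coord_is_diff 1 w.
have dE : is_diff w (fun z : 'rV[R]_2 => expR (z 0 0)) _ :=
  is_diff_comp c0 (is_diff_of_derive (is_derive_expR _)).
have dC : is_diff w (fun z : 'rV[R]_2 => cos (z 0 1)) _ :=
  is_diff_comp c1 (is_diff_of_derive (is_derive_cos _)).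
have dS : is_diff w (fun z : 'rV[R]_2 => sin (z 0 1)) _ :=
  is_diff_comp c1 (is_diff_of_derive (is_derive_sin _)).
have d1 := is_diff_vecZ e (is_diffM dE dC).
have d2 := is_diff_vecZ (e *m J) (is_diffM dE dS).
have d := is_diffD (is_diffD (is_diff_cst p w) d1) d2.
apply: (is_diff_eq d); apply/funext => h.
pose d0 := covec (delta_mx (0 : 'I_2) 0) h; pose d1' :=
  covec (delta_mx (1 : 'I_2) 0) h.
rewrite -[LHS]/(0 + (expR (w 0 0) * (d1' * - sin (w 0 1))
     + cos (w 0 1) * (d0 * expR (w 0 0))) *: e
  + (expR (w 0 0) * (d1' * cos (w 0 1))
     + sin (w 0 1) * (d0 * expR (w 0 0))) *: (e *m J)).
rewrite /d0 /d1' !covec_coordE.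
rewrite exp_curveE -!scalemxAl mulmxDl -!scalemxAl mulJJ.
apply/rowP => j; rewrite !mxE; ring.
Qed.

Lemma exp_curve_period x : exp_curve (point2 x (pi *+ 2)) =
    exp_curve (point2 x 0).
Proof. by rewrite /exp_curve !point2_fst !point2_snd cos2pi sin2pi cos0 sin0.
  Qed.

Lemma exp_curve_neq w : exp_curve w != p.
Proof.
rewrite -subr_eq0 exp_curveE scaler_eq0 gt_eqF ?expR_gt0 //=.
apply/eqP => z0; move/eqP: e0; apply.
set c := cos _ in z0; set s := sin _ in z0.
have -> : e = c *: (c *: e + s *: (e *m J)) -
  s *: ((c *: e + s *: (e *m J)) *m J).
  rewrite mulmxDl -!scalemxAl mulJJ.
  have := cos2Dsin2 (w 0 1); rewrite -/c -/s => cs.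
  by rewrite -[LHS]scale1r -cs; apply/rowP => j; rewrite !mxE; ring.
by rewrite z0 mul0mx !scaler0 subrr.
Qed.

Lemma exp_curve_near w : `|exp_curve w - p| <= expR (w 0 0)
    * (`|e| + `|e *m J|).
Proof.
rewrite exp_curveE normrZ ger0_norm ?expR_ge0 //.
apply: ler_wpM2l; first exact: expR_ge0.
apply: le_trans (ler_normD _ _) _; rewrite !normrZ; apply: lerD.
  by rewrite ler_piMl // cos_max.
by rewrite ler_piMl // sin_max.
Qed.

Lemma exp_curve_ball (d : R) : 0 < d ->
  exists r : R, forall w : 'rV[R]_2, w 0 0 <= r -> `|exp_curve w - p| < d.
Proof.
move=> d0; pose C := `|e| + `|e *m J| + 1.
have C0 : 0 < C by rewrite ltr_wpDl // addr_ge0.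
exists (ln (d / C)) => w wr; apply: le_lt_trans (exp_curve_near w) _.
have : expR (w 0 0) <= d / C by rewrite -[d / C]lnK ?ler_expR // posrE divr_gt0.
rewrite ler_pdivlMr //; apply: lt_le_trans.
by rewrite ltr_pM2l ?expR_gt0 // /C ltrDl.
Qed.

Lemma is_diff_exp_curve_comp (n : nat) (k : 'rV[R]_(m + m) -> 'rV[R]_(n + n)) w
    (W : 'rV[R]_(n + n) -> R) (G : 'cV[R]_(n + n)) :
  let Y := (exp_curve w - p) *m jacobian k (exp_curve w) in
  differentiable k (exp_curve w) ->
  Jmx R m *m jacobian k (exp_curve w) = jacobian k (exp_curve w) *m Jmx R n ->
  is_diff (k (exp_curve w)) W (covec G) ->
  is_diff w (fun w => W (k (exp_curve w))) (covec (point2 (covec G Y)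
    (covec G (Y *m Jmx R n)))^T).
Proof.
move=> Y kd kJ Wd.
have d1 : is_diff w (fun w => k (exp_curve w)) _ :=
  is_diff_comp (exp_curve_diff w) (differentiableP kd).
apply: (is_diff_eq (is_diff_comp d1 Wd)); apply/funext => h.
rewrite -[LHS]/(covec G ('d k (exp_curve w) (h 0 0 *: (exp_curve w - p)
  + h 0 1 *: ((exp_curve w - p) *m J)))).
have dkE v : 'd k (exp_curve w) v = v *m jacobian k (exp_curve w)
  by rewrite /jacobian mul_rV_lin1.
rewrite dkE mulmxDl -!scalemxAl covecD !covecZ -[_ *m J *m _]mulmxA kJ mulmxA.
by rewrite [RHS]covecE big_ord_recl big_ord1 (_ : lift _ _ = 1) ?mxE //;
  exact: val_inj.
Qed.

End HolomorphicCurve.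

Section NoMaximum.
Variables (R : realType) (m n : nat).
Variables (k : 'rV[R]_(m + m) -> 'rV[R]_(n + n)) (p e : 'rV[R]_(m + m)) (s : R).
Hypothesis s0 : 0 < s.
Hypothesis e0 : e != 0.
Hypothesis k_holo : forall z, ball p s z ->
  differentiable k z /\ Jmx R m *m jacobian k z = jacobian k z *m Jmx R n.
Hypothesis k_inj : forall z, ball p s z -> k z = k p -> z = p.

Variables (f : 'rV[R]_(n + n) -> R) (be : 'rV[R]_(n + n) -> 'cV[R]_(n + n)).
Variables (H : 'M[R]_(n + n)) (r : R).
Hypothesis r0 : 0 < r.
Hypothesis f_be : forall y, ball (k p) r y -> is_diff y f (covec (be y)).
Hypothesis Hs : H^T = H.
Hypothesis be_H : forall a : R, 0 < a -> exists2 d : R, 0 < d & forall h :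
  'rV[R]_(n + n), `|h| < d ->
      `|be (k p + h) - be (k p) - (h *m H)^T| <= a * `|h|.

Local Notation J := (Jmx R n).

Hypothesis levi : forall v : 'rV[R]_(n + n), v != 0 ->
  0 < covec (H *m v^T) v + covec (H *m (v *m J)^T) (v *m J).

(** The holomorphic quadratic polynomial P with Re P = [rePart] and Im P =
    [imPart] is the pluriharmonic part of the second-order expansion of f at
    k p. In its real part H is replaced by [reH], which differs from H by half
    of the Levi matrix H + J H J^T; [imH] is the matrix for which P is
    holomorphic. *)
Definition reH : 'M[R]_(n + n) := 2^-1 *: (H - J *m H *m J^T).
Definition imH : 'M[R]_(n + n) := - (2^-1 *: (J *m H + H *m J^T)).

Lemma reH_sym : reH^T = reH.
Proof. by rewrite /reH linearZ linearB /= !trmx_mul trmxK Hs mulmxA. Qed.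

Lemma imH_sym : imH^T = imH.
Proof. by rewrite /imH linearN linearZ linearD /= !trmx_mul trmxK Hs [_ +
  J *m H]addrC. Qed.

(** The Cauchy-Riemann equations for the quadratic part of P. *)
Lemma J_imH : J *m imH = reH.
Proof.
rewrite /imH /reH mulmxN -scalemxAr mulmxDr !mulmxA Jmx_mul mulNmx mul1mx.
by rewrite -scalerN opprD opprK.
Qed.

Definition rePart (h : 'rV[R]_(n + n)) :=
  covec (be (k p)) h + 2^-1 * covec (reH *m (h - 0)^T) (h - 0).
Definition imPart (h : 'rV[R]_(n + n)) :=
  covec (- (J *m be (k p))) h + 2^-1 * covec (imH *m (h - 0)^T) (h - 0).

(** By Taylor's formula f (k p + h) - f (k p) - Re P (h) is a quarter of the
    Levi form of f at h, up to o(|h|^2), and the Levi form is positive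
    definite. *)
Lemma pluriharmonic_lower_bound : exists c d : R,
    [/\ 0 < c, 0 < d & forall h, `|h| < d ->
  f (k p) + rePart h + c * `|h| ^+ 2 <= f (k p + h)].
Proof.
pose S := H + J *m H *m J^T.
have Ss : S^T = S by rewrite /S linearD /= !trmx_mul trmxK Hs mulmxA.
have SE v : covec (S *m v^T) v = covec (H *m v^T) v + covec (H *m (v *m J)^T)
  (v *m J).
  by rewrite /S mulmxDl /covec mulmxDr mxE trmx_mul !mulmxA.
have [|c c0 cP] := posdef_coercive Ss; first by move=> v v0; rewrite SE;
  exact: levi.
(* A quarter of the Levi form is at least c / 4; half of this absorbs the error
   of the expansion. *)
have c8 : 0 < c / 8 by exact: divr_gt0.
have [d d0 dP] := taylor2 r0 f_be be_H c8.
exists (c / 8), d; split => // h hd.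
have := dP h hd; have := cP h.
have -> : covec (h *m H)^T h = covec (reH *m (h - 0)^T) (h - 0)
  + 2^-1 * covec (S *m h^T) h.
  rewrite subr0 trmx_mul Hs /S /reH /covec -!scalemxAl -!scalemxAr !mulmxBl
    !mulmxDl !mulmxBr !mulmxDr !mxE.
  by field.
rewrite /rePart; move: (covec (S *m _) h) (covec (reH *m _) _) (`|h| ^+ 2)
  (covec (be _) h) => x y z w.
by rewrite ler_norml => xP /andP[]; lra.
Qed.

(** At a maximum of f \o k along the complex line, [rePart] would be negative at
    k z - k p for z <> p near p on the line, by [pluriharmonic_lower_bound]. But
    it is the real part of a complex differentiable function along the line, so
    [periodic_mean_zero] in the coordinate of [exp_curve] gives it a zero. *)
Lemma strictly_psh_not_max :
  ~ (forall a b : R, ball p s (p + a *: e + b *: (e *m Jmx R m)) ->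
       f (k (p + a *: e + b *: (e *m Jmx R m))) <= f (k p)).
Proof.
move=> fmax.
have [c [d [c0 d0 cP]]] := pluriharmonic_lower_bound.
have pp : ball p s p by exact: ballxx.
have k_cont : {for p, continuous k} by exact: differentiable_continuous
  (k_holo pp).1.
have [s'' s''0 kd''] := continuous_dist k_cont d0.
pose s' := Num.min s s''.
have s'0 : 0 < s' by rewrite lt_min s0.
have s's : s' <= s by rewrite ge_min lexx.
have kd z : `|z - p| < s' -> `|k z - k p| < d.
  by rewrite lt_min => /andP[_]; exact: kd''.
have rePart_continuous : {for 0, continuous rePart}.
  apply: differentiable_continuous.
  exact: (@ex_diff _ _ _ _ _ _ _ (quadratic_is_diff (be (k p)) 0 0 reH_sym)).
have rePart0 : rePart 0 = 0.
  by rewrite /rePart subr0 /covec !mul0mx !mxE mulr0 addr0.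
have [rho rhoP] := exp_curve_ball p e s'0.
pose Z := exp_curve p e.
have Zb (w : 'rV[R]_2) : w 0 0 <= rho -> ball p s (Z w).
  by move=> /rhoP wr; rewrite -ball_normE /= distrC; exact: lt_le_trans wr s's.
(* The real and imaginary parts of P along the line, in the coordinate
   log zeta. *)
pose u w := rePart (k (Z w) - k p).
pose v w := imPart (k (Z w) - k p).
have shift_diff (W : 'rV[R]_(n + n) -> R) G y : is_diff (y - k p) W (covec G) ->
    is_diff y (fun y => W (y - k p)) (covec G).
  move=> /covec_is_diffP WP; apply/covec_is_diffP => a a0.
  have [d1 d10 P1] := WP a a0; exists d1 => // h hd.
  by rewrite [y + h - k p]addrAC; exact: P1.
have [y uy] : exists y, u (point2 (rho - 1) y) = 0.
  apply: (@periodic_mean_zero R rho (pi *+ 2) u v);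
    last by rewrite ltrBlDr ltrDl.
  - by rewrite mulrn_wgt0 // pi_gt0.
  - move=> w /ltW/Zb Zw; have [dk Jk] := k_holo Zw.
    have du := is_diff_exp_curve_comp dk Jk
      (shift_diff _ _ _ (quadratic_is_diff (be (k p)) 0 (k (Z w) -
      k p) reH_sym)).
    have dv := is_diff_exp_curve_comp dk Jk
      (shift_diff _ _ _ (quadratic_is_diff (- (J *m be (k p))) 0 (k (Z w) -
      k p) imH_sym)).
    eexists; eexists; split; [exact: du|exact: dv|].
    rewrite [LHS]mxE [RHS]mxE point2_fst point2_snd -[RHS]covec_mulmx;
      congr (covec _ _).
    rewrite mulmxDr mulmxN mulmxA Jmx_mul mulNmx mul1mx opprK; congr (_ + _).
    by rewrite subr0 !trmx_mul imH_sym reH_sym mulmxA J_imH.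
  - by move=> x _; rewrite /v /Z exp_curve_period.
  - move=> a a0.
    have [d1 d10 P1] := continuous_dist rePart_continuous a0.
    have [s1 s10 P2] := continuous_dist k_cont d10.
    have [r1 P3] := exp_curve_ball p e s10.
    exists (Num.min (rho - 1) r1) => [|y]; first by rewrite gt_min ltrBlDr ltrDl
      ltr01.
    have := P1 (k (Z (point2 (Num.min (rho - 1) r1) y)) - k p).
    rewrite subr0 rePart0 subr0 => P; apply/ltW/P/P2/P3.
    by rewrite point2_fst ge_min lexx orbT.
pose z := Z (point2 (rho - 1) y).
have zb : ball p s z by apply: Zb; rewrite point2_fst lerBlDr lerDl.
have kz : k z - k p != 0.
  rewrite subr_eq0; apply/eqP => /(k_inj zb) /eqP; apply/negP;
    exact: exp_curve_neq.
have : f (k z) <= f (k p) by exact: fmax.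
have := cP (k z - k p); rewrite [k p + _]addrC subrK.
have -> : rePart (k z - k p) = 0 by exact: uy.
move=> h; have /h : `|k z - k p| < d.
  apply: kd; apply: rhoP; rewrite point2_fst lerBlDr lerDl //.
have : 0 < c * `|k z - k p| ^+ 2 by rewrite mulr_gt0 // exprn_gt0 // normr_gt0.
move: (c * _) => x; lra.
Qed.

End NoMaximum.

(** * Number fields *)

Lemma intr_in_alg (K : fieldExtType rat) (z : int) : z%:~R =
    (z%:~R : rat)%:A :> K.
Proof. by rewrite -in_algE rmorph_int. Qed.

(** Let p be the minimal polynomial of x, of degree n, and a a common
    denominator of its coefficients. Multiplying the coefficient of X^i by a^(n
    - i) gives a monic polynomial with integral coefficients and root a x. *)
Lemma integral_multiple (K : fieldExtType rat) (x : K) :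
  exists2 m : int, m != 0 & integralOver (intr : int -> K) (m%:~R * x).
Proof.
have /polyOver1P[q0 pE] := minPolyOver 1 x.
have [q [a a0 qE]] := rat_poly_scale q0.
pose p := minPoly 1 x.
have coefp i : a%:~R * p`_i = (q`_i)%:~R :> K.
  rewrite /p pE coef_map /= qE coefZ coef_map /=.
  by rewrite !intr_in_alg mulr_algl scalerA mulrA mulfV ?intr_eq0 // mul1r.
exists a => //.
pose n := (size p).-1.
have sp : size p = n.+1 by rewrite /n prednK // size_poly_gt0 monic_neq0 //
  monic_minPoly.
have pn : p`_n = 1 by have /monicP := monic_minPoly 1 x;
  rewrite /lead_coef -/p sp.
pose P := \poly_(i < n.+1) (a%:~R ^+ (n - i) * p`_i).
have PE i : (i <= n)%N -> P`_i = a%:~R ^+ (n - i) * p`_i by move=> ni;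
  rewrite coef_poly ltnS ni.
have Pn : P`_n = 1 by rewrite PE // subnn expr0 mul1r.
have sP : size P = n.+1 by rewrite size_poly_eq // subnn expr0 mul1r pn
  oner_eq0.
apply: (@integral_root_monic _ _ _ _ P).
- by rewrite monicE /lead_coef sP Pn.
- apply/rootP; rewrite horner_poly.
  transitivity (a%:~R ^+ n * p.[x]); last by rewrite (rootP (root_minPoly 1 x))
    mulr0.
  rewrite horner_coef sp mulr_sumr; apply: eq_bigr => i _.
  have -> : a%:~R ^+ n = a%:~R ^+ (n - i) * a%:~R ^+ i :> K.
    by rewrite -exprD subnK // -ltnS.
  rewrite exprMn; move: (a%:~R ^+ i) (x ^+ i) (a%:~R ^+ (n - i)) => u v w; ring.
apply/integral_poly => i.
have [ni|ni] := leqP n.+1 i; first by rewrite nth_default ?sP //;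
  exact: mxpoly.integral0.
have [->|i_n] := eqVneq i n; first by rewrite Pn; exact: mxpoly.integral1.
have lt_i : (i < n)%N by rewrite ltn_neqAle i_n.
rewrite PE // -(subnSK lt_i) exprSr -mulrA coefp; apply: mxpoly.integral_mul.
  by rewrite -rmorphXn /=; exact: mxpoly.integral_id.
exact: mxpoly.integral_id.
Qed.

(** A basis of K over the rationals remains one when its elements are multiplied
    by nonzero integers, which makes them integral, and by d. Used with
    d = a - 1, it provides generators of a lattice of periods. *)
Lemma integral_spanning_family (K : fieldExtType rat) (N : nat) (d : K) :
  \dim {:K} = N -> d != 0 ->
  exists2 b : 'I_N -> K, forall k, integralOver (intr : int -> K) (b k) &
    forall y, exists q : 'I_N -> rat, y = \sum_k q k *: (d * b k).
Proof.
move=> <- d0; pose e (k : 'I_(\dim {:K})) := (vbasis {:K})`_k.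
have /choice[m mP] : forall k, exists m : int,
  m != 0 /\ integralOver (intr : int -> K) (m%:~R * e k).
  by move=> k; have [m m0 mi] := integral_multiple (e k); exists m.
exists (fun k => (m k)%:~R * e k) => [k|y]; first by case: (mP k).
exists (fun k => coord (vbasis {:K}) k (y / d) / (m k)%:~R).
have yd : y / d \in {:K}%VS by exact: memvf.
rewrite -[LHS](divfK d0) mulrC {1}(coord_vbasis yd) mulr_sumr;
  apply: eq_bigr => k _.
rewrite -scalerAr intr_in_alg mulr_algl -scalerAr scalerA divfK //.
by rewrite intr_eq0; case: (mP k).
Qed.

(** Dedekind's argument: from a relation of minimal support, subtract sigma_i0
    (a) times it from the same relation evaluated at a y. The term of i0
    disappears, and another one survives if a separates two embeddings. *)
Lemma embeddings_independent (K L : fieldType) (N : nat)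
    (sigma : 'I_N -> {rmorphism K -> L}) :
  (forall i j, (forall a, sigma i a = sigma j a) -> i = j) ->
  forall c : 'I_N -> L, (forall y, \sum_i c i * sigma i y = 0) -> forall i,
    c i = 0.
Proof.
move=> inj c; have [n] := ubnP #|[pred i | c i != 0]|.
elim: n c => // n IH c; rewrite ltnS => cn cP i0; apply/eqP/negPn/negP => ci0.
have [j /andP[ji cj]|nj] := pickP [pred j | (j != i0) && (c j != 0)];
  last first.
  have := cP 1; rewrite (bigD1 i0) //= rmorph1 mulr1 big1 ?addr0 => [/eqP|j ji];
    first exact/negP.
  by have := nj j; rewrite /= ji /= => /negbFE/eqP ->; rewrite mul0r.
have [a aP] : exists a, sigma j a != sigma i0 a.
  apply: contrapT => na; move/eqP: ji; apply; apply: inj => a.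
  by apply/eqP/negPn/negP => h; apply: na; exists a.
(* A relation between fewer embeddings, in which j still occurs. *)
pose c' i := c i * (sigma i a - sigma i0 a).
have : c' j = 0.
  apply: IH => [|y].
    apply: leq_trans cn; apply: proper_card; apply/fintype.properP; split.
      by apply/fintype.subsetP => i; rewrite !inE; apply: contra => /eqP;
        rewrite /c' => ->; rewrite mul0r.
    by exists i0; rewrite !inE // /c' subrr mulr0 eqxx.
  transitivity (\sum_i c i * sigma i (a * y) -
    sigma i0 a * \sum_i c i * sigma i y).
    rewrite mulr_sumr -sumrB; apply: eq_bigr => i _; rewrite /c' rmorphM; ring.
  by rewrite !cP mulr0 subrr.
by move/eqP; rewrite mulf_eq0 (negPf cj) /= subr_eq0; apply/negP.
Qed.

Lemma conj_sum (R : realType) (N : nat) (F : 'I_N -> R[i]) :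
  conjc (\sum_k F k) = \sum_k conjc (F k).
Proof. exact: (rmorph_sum (@conjc R)). Qed.

(** The vectors (sigma_j (b k))_j span R^s x C^t over R. The square matrix of
    all sigma_i (b k), conjugate embeddings included, is invertible by
    independence, so w extended by its conjugates is a complex combination of
    its columns. Conjugation permutes the equations, so the conjugate
    coefficients solve them too, and so do the real parts. *)
Lemma embeddings_span (R : realType) (s t : nat) (K : fieldExtType rat)
    (sigma : 'I_(s + t + t) -> {rmorphism K -> R[i]})
      (b : 'I_(s + t + t) -> K) :
  ordered_embeddings sigma ->
  (forall y, exists q : 'I_(s + t + t) -> rat, y = \sum_k q k *: b k) ->
  forall w : 'I_(s + t) -> R[i], (forall i : 'I_s, complex.Im (w (lshift t i)) =
    0) ->
  exists c : 'I_(s + t + t) -> R, forall j : 'I_(s + t),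
    w j = \sum_k (c k)%:C%C * sigma (lshift t j) (b k).
Proof.
move=> [inj real_s _ conj_s] bP w wreal.
pose S : 'M[R[i]]_(s + t + t) := \matrix_(i, k) sigma i (b k).
have Su : S \in unitmx.
  rewrite -row_free_unit -kermx_eq0; apply/rowV0P => v /sub_kermxP vS.
  apply/rowP => i; rewrite mxE; apply: (embeddings_independent inj) => y.
  have [q ->] := bP y.
  transitivity (\sum_k ratr (q k) * (v *m S) 0 k); last first.
    by rewrite vS big1 // => k _; rewrite mxE mulr0.
  under [RHS]eq_bigr do rewrite mxE mulr_sumr.
  rewrite exchange_big; apply: eq_bigr => j _.
  rewrite rmorph_sum mulr_sumr; apply: eq_bigr => k _.
  rewrite mxE -mulr_algl rmorphM /=.
  have -> : sigma j (q k)%:A = ratr (q k)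
    by rewrite -(fmorph_eq_rat (sigma j \o in_alg K)).
  by rewrite mulrCA.
pose W : 'cV[R[i]]_(s + t + t) := \col_(i < s + t +
  t) match fintype.split i with
  | inl j => w j | inr j => conjc (w (rshift s j)) end.
pose c := invmx S *m W.
have cS i : \sum_k sigma i (b k) * c k 0 = W i 0.
  have <- : S *m c = W by rewrite /c mulKVmx.
  by rewrite [RHS]mxE; apply: eq_bigr => k _; congr (_ * _); rewrite mxE.
have Wl j : W (lshift t j) 0 = w j by rewrite mxE (fintype.unsplitK (inl j)).
have Wr j : W (rshift (s + t) j) 0 = conjc (w (rshift s j))
  by rewrite mxE (fintype.unsplitK (inr j)).
have conj_cS (j : 'I_(s + t)) : \sum_k sigma (lshift t j) (b k) * conjc (c k 0)
  = w j.
  rewrite -[j]fintype.splitK; case: (fintype.split j) => i /=.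
    have wE : conjc (w (lshift t i)) = w (lshift t i).
      by have := wreal i; case: (w _) => x y /= ->; rewrite oppr0.
    rewrite -wE -Wl -cS conj_sum; apply: eq_bigr => k _.
    rewrite rmorphM /=; congr (_ * _).
    by have := real_s i (b k); case: (sigma _ _) => x y /= ->; rewrite oppr0.
  rewrite -[RHS]conjcK -Wr -cS conj_sum; apply: eq_bigr => k _.
  by rewrite rmorphM /= conj_s.
exists (fun k => complex.Re (c k 0)) => j.
have ReE (z : R[i]) : ((complex.Re z)%:C)%C = 2^-1 * (z + conjc z).
  by rewrite ReJ_add mulrC.
under eq_bigr do rewrite ReE -mulrA mulrDl.
rewrite -mulr_sumr big_split /=.
rewrite (eq_bigr _ (fun k _ => mulrC _ _)) cS Wl.
rewrite (eq_bigr _ (fun k _ => mulrC _ _)) conj_cS.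
by field.
Qed.

(** * Linear algebra of the Vaisman condition *)

(** At a point of a chart, G is the matrix of the metric, T the column of
    components of theta, dG i and H the matrices of their partial
    derivatives. *)
Section VaismanAlgebra.
Variables (R : realType) (n : nat).
Local Notation N := (n + n)%N.
Local Notation J := (Jmx R n).
Variables (G H : 'M[R]_N) (dG : 'I_N -> 'M[R]_N) (T : 'cV[R]_N).
Hypothesis G_sym : G^T = G.
Hypothesis G_unit : G \in unitmx.
Hypothesis G_J : J *m G *m J^T = G.
Hypothesis dG_sym : forall i, (dG i)^T = dG i.
Hypothesis dG_J : forall i, J *m dG i *m J^T = dG i.
Hypothesis parallel : forall i j, H i j =
  \sum_k (2^-1 * \sum_l invmx G k l * (dG i j l + dG j i l - dG l i j)) * T k 0.
Hypothesis lck : forall i j k,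
  (dG i *m J^T) j k + (dG j *m J^T) k i + (dG k *m J^T) i j =
  T i 0 * (G *m J^T) j k + T j 0 * (G *m J^T) k i + T k 0 * (G *m J^T) i j.

Definition lee_vector : 'rV[R]_N := (invmx G *m T)^T.
Local Notation a := lee_vector.

Definition bil (B : 'M[R]_N) (v w : 'rV[R]_N) : R := (v *m B *m w^T) 0 0.

(** The derivative in the direction u of the function g(v, w), for constant
    vector fields v and w. *)
Definition dg (u v w : 'rV[R]_N) : R := \sum_i u 0 i * bil (dG i) v w.

(** Evaluation on three vectors of the tensor with components X. It turns the
    identities between components in the hypotheses into identities between
    functions of vectors, in which J and the dual of theta can be
    substituted. *)
Definition contract3 (X : 'I_N -> 'I_N -> 'I_N -> R) (u v w : 'rV[R]_N) : R :=
  \sum_i \sum_j \sum_k u 0 i * v 0 j * w 0 k * X i j k.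

Lemma bilE B v w : bil B v w = \sum_j \sum_k v 0 j * w 0 k * B j k.
Proof.
rewrite /bil mxE exchange_big; apply: eq_bigr => k _; rewrite mxE mulr_suml.
by apply: eq_bigr => j _; rewrite mxE; ring.
Qed.

Lemma bil_mulJ B v w : bil (B *m J^T) v w = bil B v (w *m J).
Proof. by rewrite /bil trmx_mul !mulmxA. Qed.

Lemma bil_sym B v w : B^T = B -> bil B v w = bil B w v.
Proof.
move=> Bs; rewrite /bil; have -> : v *m B *m w^T = (w *m B *m v^T)^T.
  by rewrite !trmx_mul trmxK Bs mulmxA.
by rewrite mxE.
Qed.

Lemma bilJJ B v w : J *m B *m J^T = B -> bil B (v *m J) (w *m J) = bil B v w.
Proof. by move=> BJ; rewrite /bil trmx_mul -{2}BJ !mulmxA. Qed.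

Lemma bilN B v w : bil B v (- w) = - bil B v w.
Proof. by rewrite /bil linearN /= mulmxN mxE. Qed.

Lemma dg_contract (P : 'M[R]_N) (u v w : 'rV[R]_N) :
  \sum_i u 0 i * bil (dG i *m P) v w = contract3 (fun i j k => (dG i *m P) j k)
    u v w.
Proof.
apply: eq_bigr => i _; rewrite bilE mulr_sumr; apply: eq_bigr => j _.
by rewrite mulr_sumr; apply: eq_bigr => k _; rewrite !mulrA.
Qed.

Lemma contract3_rot X u v w :
  contract3 (fun i j k => X j k i) u v w = contract3 X v w u.
Proof.
rewrite /contract3 exchange_big; apply: eq_bigr => j _; rewrite exchange_big.
by apply: eq_bigr => k _; apply: eq_bigr => i _; congr (_ * _); ring.
Qed.

Lemma contract3D X Y u v w :
  contract3 (fun i j k => X i j k + Y i j k) u v w =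
    contract3 X u v w + contract3 Y u v w.
Proof.
rewrite /contract3 -big_split; apply: eq_bigr => i _; rewrite -big_split.
by apply: eq_bigr => j _; rewrite -big_split; apply: eq_bigr => k _;
  rewrite mulrDr.
Qed.

Lemma contract3N X u v w :
  contract3 (fun i j k => - X i j k) u v w = - contract3 X u v w.
Proof.
rewrite /contract3 -sumrN; apply: eq_bigr => i _; rewrite -sumrN.
by apply: eq_bigr => j _; rewrite -sumrN; apply: eq_bigr => k _; rewrite mulrN.
Qed.

Lemma contract3_prod (B : 'M[R]_N) (u v w : 'rV[R]_N) :
  contract3 (fun i j k => T i 0 * B j k) u v w = covec T u * bil B v w.
Proof.
rewrite covecE mulr_suml; apply: eq_bigr => i _; rewrite bilE mulr_sumr.
by apply: eq_bigr => j _; rewrite mulr_sumr; apply: eq_bigr => k _; ring.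
Qed.

Lemma lck_contract (u v w : 'rV[R]_N) :
  dg u v (w *m J) + dg v w (u *m J) + dg w u (v *m J) =
  covec T u * bil G v (w *m J) + covec T v * bil G w (u *m J)
  + covec T w * bil G u (v *m J).
Proof.
have dgJ (u1 v1 w1 : 'rV[R]_N) : dg u1 v1 (w1 *m J) =
  contract3 (fun i j k => (dG i *m J^T) j k) u1 v1 w1.
  by rewrite -dg_contract; apply: eq_bigr => i _; rewrite bil_mulJ.
rewrite !dgJ -!bil_mulJ -!contract3_prod.
rewrite -[contract3 _ v w u in LHS]contract3_rot.
rewrite -[contract3 _ w u v in LHS]contract3_rot
  -[contract3 _ v w u in LHS]contract3_rot.
rewrite -[contract3 _ v w u in RHS]contract3_rot.
rewrite -[contract3 _ w u v in RHS]contract3_rot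
  -[contract3 _ v w u in RHS]contract3_rot.
rewrite -!contract3D /contract3; apply: eq_bigr => i _; apply: eq_bigr => j _.
by apply: eq_bigr => k _; rewrite lck.
Qed.

Lemma invmx_sym : (invmx G)^T = invmx G.
Proof. by rewrite trmx_inv G_sym. Qed.

Lemma parallel_lee i j : H i j =
  2^-1 * \sum_l a 0 l * (dG i j l + dG j i l - dG l i j).
Proof.
rewrite parallel; under eq_bigr do rewrite -mulrA mulr_suml.
rewrite -mulr_sumr exchange_big; congr (_ * _); apply: eq_bigr => l _.
rewrite /lee_vector mxE mxE mulr_suml; apply: eq_bigr => k _.
by rewrite -[in RHS]invmx_sym mxE; ring.
Qed.

(** When theta is parallel its derivatives are theta applied to the Christoffel
    symbols. Pairing with theta is pairing with its dual vector a for g, which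
    cancels the inverse of the metric. *)
Lemma parallel_contract (u v : 'rV[R]_N) : bil H u v =
    2^-1 * (dg u v a + dg v u a - dg a u v).
Proof.
have dgE (u1 v1 w1 : 'rV[R]_N) : dg u1 v1 w1 =
  contract3 (fun i j k => dG i j k) u1 v1 w1.
  have := dg_contract 1%:M u1 v1 w1.
  rewrite /dg /contract3; under eq_bigr do rewrite mulmx1.
  move=> ->; do 3 (apply: eq_bigr => ? _); by rewrite mulmx1.
rewrite !dgE.
have -> : contract3 (fun i j k => dG i j k) v u a =
  contract3 (fun i j k => dG j i k) u v a.
  rewrite /contract3 exchange_big; apply: eq_bigr => i _; apply: eq_bigr => j _.
  by apply: eq_bigr => k _; congr (_ * _); ring.
rewrite -[contract3 _ a u v]contract3_rot -[contract3 _ v a u]contract3_rot.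
rewrite -contract3N -!contract3D bilE /contract3 mulr_sumr;
  apply: eq_bigr => i _.
rewrite mulr_sumr; apply: eq_bigr => j _; rewrite parallel_lee !mulr_sumr.
by apply: eq_bigr => l _; ring.
Qed.

Lemma lee_bil v : bil G a v = covec T v.
Proof.
rewrite bil_sym // /bil /covec /lee_vector trmxK -mulmxA mulKVmx //.
Qed.

(** By [parallel_contract] the left side is a combination of derivatives of g,
    where the derivatives in the direction a add up to - dg a v v because dg a
    is invariant under J. The equation d omega = theta /\ omega on (v, J v, a)
    expresses the same combination through theta and g. *)
Lemma levi_identity (v : 'rV[R]_N) : bil H v v + bil H (v *m J) (v *m J) =
  covec T v ^+ 2 + covec T (v *m J) ^+ 2 - covec T a * bil G v v.
Proof.
rewrite !parallel_contract.
have dgJJ (u v1 w1 : 'rV[R]_N) : dg u (v1 *m J) (w1 *m J) = dg u v1 w1.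
  by apply: eq_bigr => i _; rewrite bilJJ.
have dgC (u v1 w1 : 'rV[R]_N) : dg u v1 w1 = dg u w1 v1.
  by apply: eq_bigr => i _; rewrite bil_sym.
have dgN (u v1 w1 : 'rV[R]_N) : dg u v1 (- w1) = - dg u v1 w1.
  by rewrite /dg -sumrN; apply: eq_bigr => i _; rewrite bilN mulrN.
have := lck_contract v (v *m J) a.
rewrite dgJJ mulJJ dgN (dgC (v *m J) a) bilJJ // (bil_sym v) // lee_bil bilN.
rewrite lee_bil dgJJ.
lra.
Qed.

(** The left side is the derivative of |theta|^2 in the direction u; see
    [lee_norm2_diff0]. *)
Lemma lee_norm_identity (u : 'rV[R]_N) : 2 * bil H u a - dg u a a = 0.
Proof. rewrite parallel_contract. lra. Qed.

End VaismanAlgebra.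

(** * Vaisman metrics in a chart *)

Lemma partials_is_diff (R : realType) (N : nat) (f : 'rV[R]_N -> R)
    (x : 'rV[R]_N) :
  differentiable f x -> is_diff x f (covec (\col_k partial k f x)).
Proof.
move=> fd; apply: (is_diff_eq (differentiableP fd)); apply/funext => h.
rewrite covecE [in LHS](row_sum_delta h) linear_sum; apply: eq_bigr => k _.
by rewrite linearZ /= mxE /partial deriveE.
Qed.

Lemma partial_is_diff (R : realType) (N : nat) (f : 'rV[R]_N -> R)
    (x : 'rV[R]_N) M i :
  is_diff x f (covec M) -> partial i f x = M i 0.
Proof.
move=> [fd dE]; rewrite /partial deriveE //.
by rewrite -[RHS]covec_delta -dE.
Qed.

(** The expansion that [closed_at] and [taylor2] ask for, from differentiability
    of the components. *)
Lemma column_expansion (R : realType) (N m : nat) (th : 'rV[R]_N -> 'cV[R]_m)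
    (x : 'rV[R]_N) : (forall k, differentiable (fun y => th y k 0) x) ->
  forall e : R, 0 < e -> exists2 d : R, 0 < d & forall h : 'rV[R]_N, `|h| < d ->
    `|th (x + h) - th x - (h *m \matrix_(i, k) partial i (fun y => th y k 0)
      x)^T|
      <= e * `|h|.
Proof.
move=> thd e e0.
have /choice[d dP] : forall k, exists d : R, 0 < d /\ forall h : 'rV[R]_N,
  `|h| < d ->
    `|th (x + h) k 0 - th x k 0 - covec (\col_i partial i (fun y => th y k 0) x)
      h| <= e * `|h|.
  by move=> k; have /covec_is_diffP/(_ e e0)[d d0 dP] :=
    partials_is_diff (thd k); exists d.
exists (\big[Num.min/1]_k d k).
  by apply/bigmin_gtP; split => // k _; case: (dP k).
move=> h /bigmin_gtP[_ hd].
rewrite [leLHS]/Num.Def.normr /= mx_normrE; apply/bigmax_leP;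
  split => [|[k j] _ /=].
  by rewrite mulr_ge0 // ltW.
rewrite (ord1 j) !mxE; have [_ /(_ h (hd k isT))] := dP k.
congr (`|_ - _| <= _); rewrite covecE; apply: eq_bigr => i _.
by rewrite !mxE.
Qed.

Lemma is_derive_sumM (R : realType) (V : normedModType R) (N : nat)
    (f g : 'I_N -> V -> R) (df dg : 'I_N -> R) (x v : V) :
  (forall k, is_derive x v (f k) (df k)) -> (forall k, is_derive x v (g k)
    (dg k)) ->
  is_derive x v (fun y => \sum_k f k y * g k y)
    (\sum_k (f k x * dg k + g k x * df k)).
Proof.
move=> fP gP.
have -> : (fun y => \sum_k f k y * g k y) = \sum_k (f k * g k).
  by apply/funext => y; rewrite fct_sumE.
have h k : is_derive x v (f k * g k) (f k x * dg k + g k x * df k).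
  exact: (@is_deriveM _ _ (f k) (g k) x v (df k) (dg k) (fP k) (gP k)).
exact: (is_derive_sum (h := fun k => f k * g k) h).
Qed.

Lemma derive_mulmx_const (R : realType) (V : normedModType R) (m n p q : nat)
    (G : V -> 'M[R]_(m, n)) (dG : 'M[R]_(m, n)) (P : 'M[R]_(p, m))
      (Q : 'M[R]_(n, q)) (x v : V) :
  (forall j k, is_derive x v (fun y => G y j k) (dG j k)) ->
  forall j k, is_derive x v (fun y => (P *m G y *m Q) j k) ((P *m dG *m Q) j k).
Proof.
move=> GP j k.
have inner b : is_derive x v (fun y => \sum_l P j l * G y l b) ((P *m dG) j b).
  have := @is_derive_sumM R V m (fun l => cst (P j l)) (fun l y => G y l b)
    (fun=> 0) (fun l => dG l b) x v (fun l => is_derive_cst (P j l) x v)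
      (fun l => GP l b).
  by under eq_bigr do rewrite mulr0 addr0; rewrite mxE.
have := @is_derive_sumM R V n (fun b y => \sum_l P j l * G y l b)
  (fun b => cst (Q b k))
    (fun b => (P *m dG) j b) (fun=> 0) x v inner
      (fun b => is_derive_cst (Q b k) x v).
under eq_bigr do rewrite mulr0 add0r mulrC.
have -> : (fun y => \sum_k0 (\sum_l P j l * G y l k0) * cst (Q k0 k) y) =
  (fun y => (P *m G y *m Q) j k).
  by apply/funext => y; rewrite mxE; apply: eq_bigr => b _; rewrite mxE.
by rewrite [X in is_derive _ _ _ X -> _](_ : _ =
  (P *m dG *m Q) j k) // [RHS]mxE.
Qed.

Lemma differentiable_bigsum (R : realType) (V : normedModType R) (I : Type)
    (r : seq I)
    (f : I -> V -> R) (x : V) : (forall i, differentiable (f i) x) ->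
  differentiable (fun y => \sum_(i <- r) f i y) x.
Proof.
move=> fd; elim: r => [|i r IH].
  under eq_fun do rewrite big_nil.
  exact: differentiable_cst.
under eq_fun do rewrite big_cons.
exact: (differentiableD (fd i) IH).
Qed.

Lemma differentiable_bigprod (R : realType) (V : normedModType R) (I : Type)
    (r : seq I)
    (f : I -> V -> R) (x : V) : (forall i, differentiable (f i) x) ->
  differentiable (fun y => \prod_(i <- r) f i y) x.
Proof.
move=> fd; elim: r => [|i r IH].
  under eq_fun do rewrite big_nil.
  exact: differentiable_cst.
under eq_fun do rewrite big_cons.
exact: (differentiableM (fd i) IH).
Qed.

Lemma differentiable_cstM (R : realType) (V : normedModType R) (c : R)
    (f : V -> R)
    (x : V) : differentiable f x -> differentiable (fun y => c * f y) x.
Proof. move=> fd; exact: (differentiableM (differentiable_cst c x) fd). Qed.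

Lemma differentiable_det (R : realType) (V : normedModType R) (n : nat)
    (G : V -> 'M[R]_n) (x : V) : (forall i j,
      differentiable (fun y => G y i j) x) ->
  differentiable (fun y => \det (G y)) x.
Proof.
move=> Gd; rewrite /determinant; apply: differentiable_bigsum => s.
apply: differentiable_cstM; apply: differentiable_bigprod => i; exact: Gd.
Qed.

Lemma differentiable_invmx (R : realType) (V : normedModType R) (n : nat)
    (G : V -> 'M[R]_n) (x : V) (r : R) : 0 < r ->
  (forall y, ball x r y -> G y \in unitmx) ->
  (forall i j, differentiable (fun y => G y i j) x) ->
  forall i j, differentiable (fun y => invmx (G y) i j) x.
Proof.
move=> r0 Gu Gd i j.
have dd : differentiable (fun y => (\det (G y))^-1 * (\adj (G y)) i j) x.
  apply: (@differentiableM _ _ (fun y => (\det (G y))^-1)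
    (fun y => (\adj (G y)) i j)).
    apply: differentiableV; first exact: differentiable_det.
    by have := Gu x (ballxx x r0); rewrite unitmxE unitfE.
  under eq_fun do rewrite mxE; apply: differentiable_cstM.
  by apply: differentiable_det => a b; under eq_fun do rewrite !mxE.
apply: (@ex_diff _ _ _ _ _ _ _ (near_eq_is_diff r0 _ (differentiableP dd))) =>
  y /Gu Gy.
by rewrite /invmx Gy [RHS]mxE.
Qed.

Lemma open_ball (R : realType) (V : normedModType R) (A : set V) (x : V) :
  open A -> A x -> exists2 r : R, 0 < r & ball x r `<=` A.
Proof.
by move=> oA Ax; have /nbhs_ballP[r r0 rA] := open_nbhs_nbhs (conj oA Ax);
  exists r.
Qed.

Lemma posdef_unitmx (R : realType) (N : nat) (G : 'M[R]_N) :
  (forall v : 'rV[R]_N, v != 0 -> 0 < (v *m G *m v^T) 0 0) -> G \in unitmx.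
Proof.
move=> G0; rewrite -row_free_unit -kermx_eq0; apply/rowV0P => v /sub_kermxP vG.
apply/eqP/negPn/negP => /G0.
by rewrite vG mul0mx mxE ltxx.
Qed.

Section VaismanChart.
Variables (R : realType) (n : nat) (M : complexManifold R n).
Variables (g : bilinear_components M) (theta : one_form_components M).
Hypothesis lckP : lck_with_lee_form g theta.
Hypothesis parP : forall c x, cimage c x -> forall i j,
  cov_deriv g theta c x i j = 0.
Local Notation N := (n + n)%N.
Local Notation J := (Jmx R n).
Local Notation I := (cchart_index M).
Implicit Types (c : I) (x : 'rV[R]_N).

Definition dmetric c x (i : 'I_N) : 'M[R]_N :=
    \matrix_(j, k) partial i (fun y => g c y j k) x.
Definition dlee c x : 'M[R]_N := \matrix_(i, j) partial i
    (fun y => theta c y j 0) x.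

Lemma g_diff c x j k : cimage c x -> differentiable (fun y => g c y j k) x.
Proof. by case: lckP => [[[gs _] _ _ _] _ _ _ _] cx;
  exact: (gs c j k [::] x cx). Qed.

Lemma theta_diff c x k : cimage c x ->
  differentiable (fun y => theta c y k 0) x.
Proof. by case: lckP => [_ [[ts _] _] _ _ _] cx; exact: (ts c k [::] x cx). Qed.

Lemma g_sym c x : cimage c x -> (g c x)^T = g c x.
Proof. by case: lckP => [[_ H _ _] _ _ _ _]; exact: H. Qed.

Lemma g_pos c x : cimage c x -> forall v, v != 0 -> 0 < bil (g c x) v v.
Proof. by case: lckP => [[_ _ H _] _ _ _ _]; exact: H. Qed.

Lemma g_J c x : cimage c x -> J *m g c x *m J^T = g c x.
Proof. by case: lckP => [[_ _ _ H] _ _ _ _]; exact: H. Qed.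

Lemma g_unit c x : cimage c x -> g c x \in unitmx.
Proof. by move=> cx; apply: posdef_unitmx; exact: g_pos. Qed.

Lemma cimage_ball c x : cimage c x -> exists2 r : R, 0 < r &
    ball x r `<=` cimage c.
Proof. exact/open_ball/cimage_open. Qed.

Lemma near_eq_partial (f h : 'rV[R]_N -> R) x c i : cimage c x ->
  (forall y, cimage c y -> f y = h y) -> partial i f x = partial i h x.
Proof.
move=> cx fh; have [r r0 rc] := cimage_ball cx; apply: near_eq_derive.
by apply/nbhs_ballP; exists r => // y /rc/fh.
Qed.

Lemma dmetric_mul c x (P Q : 'M[R]_N) i j k : cimage c x ->
  partial i (fun y => (P *m g c y *m Q) j k) x = (P *m dmetric c x i *m Q) j k.
Proof.
move=> cx; apply: derive_val; apply: derive_mulmx_const => a b.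
rewrite mxE; apply: derivableP; apply: diff_derivable; exact: g_diff.
Qed.

Lemma dmetric_sym c x i : cimage c x -> (dmetric c x i)^T = dmetric c x i.
Proof.
move=> cx; apply/matrixP => j k; rewrite !mxE.
by apply: (near_eq_partial _ cx) => y cy; rewrite -[in LHS](g_sym cy) mxE.
Qed.

Lemma dmetric_J c x i : cimage c x -> J *m dmetric c x i *m J^T = dmetric c x i.
Proof.
move=> cx; apply/matrixP => j k; rewrite -dmetric_mul // [RHS]mxE.
by apply: (near_eq_partial _ cx) => y cy; rewrite g_J.
Qed.

Lemma dlee_parallel c x i j : cimage c x -> dlee c x i j =
  \sum_k (2^-1 * \sum_l invmx (g c x) k l *
     (dmetric c x i j l + dmetric c x j i l - dmetric c x l i j))
       * theta c x k 0.
Proof.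
move=> cx; have := parP cx i j; rewrite /cov_deriv /christoffel mxE.
move/eqP; rewrite subr_eq0 => /eqP ->; apply: eq_bigr => k _.
by congr (_ * _ * _); apply: eq_bigr => l _; rewrite !mxE.
Qed.

Lemma dmetric_lck c x i j k : cimage c x ->
  (dmetric c x i *m J^T) j k + (dmetric c x j *m J^T) k i +
    (dmetric c x k *m J^T) i j =
  theta c x i 0 * (g c x *m J^T) j k + theta c x j 0 * (g c x *m J^T) k i
  + theta c x k 0 * (g c x *m J^T) i j.
Proof.
move=> cx; case: lckP => [_ _ /(_ c x cx i j k) + _ _].
rewrite /ext_deriv2 /wedge12 /fundamental_form => <-.
have E i1 j1 k1 : (dmetric c x i1 *m J^T) j1 k1 =
  partial i1 (fun y => (g c y *m J^T) j1 k1) x.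
  rewrite -[dmetric c x i1]mul1mx -dmetric_mul //.
  by apply: (near_eq_partial _ cx) => y cy; rewrite mul1mx.
by rewrite !E.
Qed.

Lemma dlee_sym c x : cimage c x -> (dlee c x)^T = dlee c x.
Proof.
move=> cx; apply/matrixP => i j; rewrite !mxE.
by case: lckP => [_ [_ cl] _ _ _]; exact: cl.
Qed.

(** The function |theta|^2, read in a chart. *)
Definition lee_norm2 c x : R := covec (theta c x)
    (lee_vector (g c x) (theta c x)).

Lemma lee_norm2_pos c x : cimage c x -> theta c x != 0 -> 0 < lee_norm2 c x.
Proof.
move=> cx t0; rewrite /lee_norm2 -(lee_bil _ (g_sym cx) (g_unit cx)).
apply: g_pos => //; apply: contra_neq t0 => a0.
have : g c x *m (lee_vector (g c x) (theta c x))^T = theta c x.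
  by rewrite /lee_vector trmxK mulKVmx // g_unit.
by rewrite a0 trmx0 mulmx0.
Qed.

Lemma chart_levi c x v : cimage c x ->
  bil (dlee c x) v v + bil (dlee c x) (v *m J) (v *m J) =
  covec (theta c x) v ^+ 2 + covec (theta c x)
    (v *m J) ^+ 2 - lee_norm2 c x * bil (g c x) v v.
Proof.
move=> cx; exact: (levi_identity (g_sym cx) (g_unit cx) (g_J cx)
  (fun i => dmetric_sym i cx) (fun i => dmetric_J i cx)
  (fun i j => dlee_parallel i j cx) (fun i j k => dmetric_lck i j k cx) v).
Qed.

(** Let a be the dual vector of theta. The product rule for |theta|^2 = theta(a)
    and for theta = g(a, .) together eliminates the derivative of a; the outcome
    vanishes by [lee_norm_identity]. *)
Lemma lee_norm2_diff0 c x : cimage c x -> is_diff x (lee_norm2 c) 0.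
Proof.
move=> cx; have [r r0 rc] := cimage_ball cx.
pose a y := lee_vector (g c y) (theta c y).
have ad k : differentiable (fun y => a y 0 k) x.
  have -> : (fun y => a y 0 k) =
    (fun y => \sum_l invmx (g c y) k l * theta c y l 0).
    by apply/funext => y; rewrite /a /lee_vector mxE mxE.
  apply: differentiable_bigsum => l.
  apply: (@differentiableM _ _ (fun y => invmx (g c y) k l)
    (fun y => theta c y l 0)); last exact: theta_diff.
  by apply: (differentiable_invmx r0) => [y /rc|i j];
    [exact: g_unit|exact: g_diff].
have NE : lee_norm2 c = (fun y => \sum_k a y 0 k * theta c y k 0).
  by apply/funext => y; rewrite /lee_norm2 covecE.
have Nd : differentiable (lee_norm2 c) x.
  rewrite NE; apply: differentiable_bigsum => k.
  by apply: (@differentiableM _ _ (fun y => a y 0 k) (fun y => theta c y k 0));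
    [|exact: theta_diff].
suff P0 i : partial i (lee_norm2 c) x = 0.
  apply: (is_diff_eq (partials_is_diff Nd)); apply/funext => h.
  by rewrite covecE big1 // => i _; rewrite mxE P0 mulr0.
pose da k := partial i (fun y => a y 0 k) x.
(* The two product rules: dN for |theta|^2 = theta(a), dT for theta =
   g(a, .). *)
have aP k : is_derive x (delta_mx 0 i) (fun y => a y 0 k) (da k).
  by apply: derivableP; exact: diff_derivable.
have tP k : is_derive x (delta_mx 0 i) (fun y => theta c y k 0) (dlee c x i k).
  by rewrite mxE; apply: derivableP; apply: diff_derivable; exact: theta_diff.
have gP k l : is_derive x (delta_mx 0 i) (fun y => g c y k l)
  (dmetric c x i k l).
  by rewrite mxE; apply: derivableP; apply: diff_derivable; exact: g_diff.
have dN : partial i (lee_norm2 c) x = \sum_k (a x 0 k * dlee c x i k +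
  theta c x k 0 * da k).
  by rewrite NE; apply: derive_val; exact: is_derive_sumM.
have dT k : dlee c x i k = \sum_l (g c x k l * da l +
  a x 0 l * dmetric c x i k l).
  have := @derive_val _ _ _ _ _ _ _ (is_derive_sumM (gP k) aP).
  move=> <-; rewrite [LHS]mxE; apply: (near_eq_partial _ cx) => y cy.
  have : (g c y *m (a y)^T) k 0 = theta c y k 0.
    by rewrite /a /lee_vector trmxK mulKVmx // g_unit.
  by move=> <-; rewrite mxE; apply: eq_bigr => l _; rewrite mxE.
have := lee_norm_identity (g_sym cx) (fun i j => dlee_parallel i j cx)
  (delta_mx 0 i).
pose X := \sum_k a x 0 k * dlee c x i k; pose B :=
  bil (dmetric c x i) (a x) (a x).
have -> : bil (dlee c x) (delta_mx 0 i) (lee_vector (g c x) (theta c x)) = X.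
  rewrite /bil -rowE mxE; apply: eq_bigr => k _; rewrite [in LHS]mxE
    [X in _ * X]mxE.
  by rewrite mulrC.
have -> : dg (dmetric c x) (delta_mx 0 i) (lee_vector (g c x) (theta c x))
    (lee_vector (g c x) (theta c x)) = B.
  rewrite /dg (bigD1 i) //= big1 => [|j /negPf ji];
    last by rewrite mxE ji mul0r.
  by rewrite mxE !eqxx mul1r addr0.
rewrite dN big_split /= -/X.
suff -> : \sum_k theta c x k 0 * da k = X - B by lra.
have -> : X = \sum_k (\sum_l a x 0 k * g c x k l * da l) + B.
  rewrite /B bilE -big_split; apply: eq_bigr => k _;
    rewrite dT mulr_sumr -big_split.
  by apply: eq_bigr => l _ /=; ring.
rewrite addrK exchange_big; apply: eq_bigr => l _; rewrite -mulr_suml;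
  congr (_ * _).
have -> : theta c x l 0 = (g c x *m (a x)^T) l 0.
  by rewrite /a /lee_vector trmxK mulKVmx // g_unit.
rewrite mxE; apply: eq_bigr => k _; rewrite [(a x)^T _ _]mxE mulrC;
  congr (_ * _).
by rewrite -[in RHS](g_sym cx) mxE.
Qed.

End VaismanChart.

(** * The pullback of the Lee form *)

Lemma mul_jacobian (R : realType) (m n : nat) (f : 'rV[R]_m -> 'rV[R]_n)
    (x v : 'rV[R]_m) :
  v *m jacobian f x = 'd f x v.
Proof. by rewrite /jacobian mul_rV_lin1. Qed.

Lemma near_eq_jacobian (R : realType) (m n : nat) (f h : 'rV[R]_m -> 'rV[R]_n)
    (x : 'rV[R]_m) (r : R) :
  0 < r -> (forall y, ball x r y -> f y = h y) -> differentiable f x ->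
  differentiable h x /\ jacobian h x = jacobian f x.
Proof.
move=> r0 fh fd; have hd := near_eq_is_diff r0 fh (differentiableP fd).
split; first exact: (@ex_diff _ _ _ _ _ _ _ hd).
have E := @diff_val _ _ _ _ _ _ _ hd.
exact: (congr1 (@lin1_mx R m n) E).
Qed.

Lemma jacobian_comp (R : realType) (m n p : nat) (f : 'rV[R]_m -> 'rV[R]_n)
    (h : 'rV[R]_n -> 'rV[R]_p) (x : 'rV[R]_m) :
  differentiable f x -> differentiable h (f x) ->
  jacobian (h \o f) x = jacobian f x *m jacobian h (f x).
Proof.
move=> fd hd; apply/row_matrixP => i; rewrite [LHS]rowE [RHS]rowE [RHS]mulmxA.
have E := congr1 (fun F => F (delta_mx 0 i)) (diff_comp fd hd).
apply: etrans (mul_jacobian _ _ _) (etrans E _).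
exact/esym/(etrans (congr1 (mulmx^~ _) (mul_jacobian f x _))
  (mul_jacobian h (f x) _)).
Qed.

Lemma is_diff_covec_comp (R : realType) (m n : nat) (f : 'rV[R]_m -> 'rV[R]_n)
    (h : 'rV[R]_n -> R) (x : 'rV[R]_m) (T : 'cV[R]_n) :
  differentiable f x -> is_diff (f x) h (covec T) ->
  is_diff x (h \o f) (covec (jacobian f x *m T)).
Proof.
move=> fd hd; apply: (is_diff_eq (is_diff_comp (differentiableP fd) hd)).
by apply/funext => v; rewrite /= covec_mulmx mul_jacobian.
Qed.

Lemma mulmxr_continuous (R : realType) (m n : nat) (A : 'M[R]_(m, n)) :
  continuous (fun v : 'rV[R]_m => v *m A).
Proof.
move=> y; apply/(@cvgrPdist_le _ _ _ (nbhs y)) => e e0; apply/nbhs_ballP.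
have C0 : 0 < m%:R * `|A| + 1 by rewrite ltr_wpDl // mulr_ge0.
exists (e / (m%:R * `|A| + 1)) => [|z /=]; first exact: divr_gt0.
rewrite -ball_normE /= ltr_pdivlMr // => yz.
rewrite -mulmxBl; apply: le_trans (norm_mulmx_le (y - z) A) _.
apply: le_trans (ltW yz); rewrite mulrAC mulrC ler_wpM2l //.
by rewrite lerDl.
Qed.

Lemma affine_differentiable (R : realType) (m n : nat) (A : 'M[R]_(m, n))
    (v : 'rV[R]_n) x :
  differentiable (fun y : 'rV[R]_m => y *m A + v) x.
Proof.
have dA : differentiable (fun y : 'rV[R]_m => y *m A) x.
  exact: (@linear_differentiable _ _ _ (mulmxr A) x
    (@mulmxr_continuous R m n A)).
exact: (differentiableD dA (differentiable_cst v x)).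
Qed.

(** Invariance of |theta|^2 under a change of coordinates with Jacobian P. *)
Lemma lee_norm_change (R : realType) (n : nat) (P G D : 'M[R]_(n + n))
    (T S : 'cV[R]_(n + n)) :
  G \in unitmx -> D \in unitmx -> G = P *m D *m P^T -> T = P *m S ->
  covec T (lee_vector G T) = covec S (lee_vector D S).
Proof.
move=> Gu Du GE TE.
have Pu : P \in unitmx.
  by move: Gu; rewrite GE -mulmxA unitmx_mul => /andP[].
rewrite {1}TE covec_mulmx; congr (covec S _).
rewrite /lee_vector -[P in LHS]trmxK -trmx_mul; congr (_^T).
have PTu : P^T \in unitmx by rewrite unitmx_tr.
have : D *m (P^T *m (invmx G *m T)) = S.
  apply: (can_inj (mulKmx Pu)).
  by rewrite -TE !mulmxA -GE mulmxV // mul1mx.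
by move=> <-; rewrite mulKmx.
Qed.

Section Pullback.
Variables (R : realType) (n : nat) (M : complexManifold R n).
Variables (X : set 'rV[R]_(n + n)) (pi : 'rV[R]_(n + n) -> M).
Variables (g : bilinear_components M) (theta : one_form_components M).
Hypothesis lckP : lck_with_lee_form g theta.
Hypothesis parP : forall c x, cimage c x -> forall i j,
  cov_deriv g theta c x i j = 0.
Hypothesis X_convex : segment_convex X.
Hypothesis X_open : forall x, X x -> exists2 r : R, 0 < r & ball x r `<=` X.
Hypothesis pi_holo : holomorphic_map_on X pi.
Local Notation E := 'rV[R]_(n + n).
Implicit Types (x y : E) (c d : cchart_index M).

Definition cpi c : E -> E := cchart c \o pi.

Lemma cpi_image c x : cdom c (pi x) -> cimage c (cpi c x).
Proof. by move=> cx; exists (pi x). Qed.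

Lemma cpi_diff c x : X x -> cdom c (pi x) ->
  differentiable (cpi c) x /\ Jmx R n *m jacobian (cpi c) x =
    jacobian (cpi c) x *m Jmx R n.
Proof. by move=> Xx cx; have [_ /(_ c cx)] := pi_holo Xx; exact. Qed.

Lemma cdom_near c x : X x -> cdom c (pi x) ->
  exists2 r : R, 0 < r & forall y, ball x r y -> X y /\ cdom c (pi y).
Proof.
move=> Xx cx; have [r1 r10 r1X] := X_open Xx.
have [pc _] := pi_holo Xx.
have : nbhs (pi x) (cdom c) by apply: open_nbhs_nbhs; split => //;
  exact: cdom_open.
move=> /pc /nbhs_ballP[r2 /= r20 r2c].
exists (Num.min r1 r2) => [|y]; first by rewrite lt_min r10.
rewrite -ball_normE /= lt_min => /andP[y1 y2]; split; first by apply: r1X;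
  rewrite -ball_normE.
by apply: r2c; rewrite -ball_normE.
Qed.

Lemma cpi_change c d x : X x -> cdom c (pi x) -> cdom d (pi x) ->
  [/\ coverlap c d (cpi c x), cpi d x = transition c d (cpi c x) &
     jacobian (cpi d) x = jacobian (cpi c) x *m jacobian (transition c d)
       (cpi c x)].
Proof.
move=> Xx cx dx; have ov : coverlap c d (cpi c x) by exists (pi x).
have [r r0 rc] := cdom_near Xx cx.
have E1 y : cdom c (pi y) -> cpi d y = transition c d (cpi c y).
  by move=> cy; rewrite /transition /cpi /= cchartK.
split => //; first exact: E1.
have [td _] := ctransition ov; have [cd _] := cpi_diff Xx cx.
have dd := differentiable_comp cd td.
have [] := near_eq_jacobian r0 _ dd (h := cpi d); first by move=> y /rc[_ /E1].
by move=> _ ->; rewrite jacobian_comp.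
Qed.

Definition chart_at (p : M) : cchart_index M := sval (cid (ccover p)).

Lemma chart_atP p : cdom (chart_at p) p.
Proof. exact: (svalP (cid (ccover p))). Qed.

Definition pull_theta c x : 'cV[R]_(n + n) :=
    jacobian (cpi c) x *m theta c (cpi c x).
(** The pullback of theta by pi. By [alphaE] every chart around pi x gives the
    same value as the chosen one. *)
Definition alpha x := pull_theta (chart_at (pi x)) x.

Lemma pull_theta_change c d x : X x -> cdom c (pi x) -> cdom d (pi x) ->
  pull_theta c x = pull_theta d x.
Proof.
move=> Xx cx dx; have [ov E1 E2] := cpi_change Xx cx dx.
case: lckP => [_ [[_ tl] _] _ _ _].
by rewrite /pull_theta (tl _ _ _ ov) E2 E1 mulmxA.
Qed.

Lemma alphaE c x : X x -> cdom c (pi x) -> alpha x = pull_theta c x.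
Proof. by move=> Xx cx; apply: pull_theta_change => //; exact: chart_atP. Qed.

Lemma chart_primitive c x : cimage c x -> exists2 r : R, 0 < r &
    ball x r `<=` cimage c /\
  exists f : E -> R, forall y, ball x r y -> is_diff y f (covec (theta c y)).
Proof.
move=> cx; have [r r0 rc] := cimage_ball cx; exists r => //; split => //.
apply: (closed_form_primitive (@ball_convex _ _ x r) (ballxx x r0)
  (@ball_subball _ _ x r)).
move=> y /rc cy; exists (dlee theta c y); first exact: (dlee_sym lckP).
exact: column_expansion (fun k => theta_diff lckP k cy).
Qed.

Lemma cpi_near c x (r : R) : X x -> cdom c (pi x) -> 0 < r ->
  exists2 s : R, 0 < s & forall y, ball x s y ->
    [/\ X y, cdom c (pi y) & ball (cpi c x) r (cpi c y)].
Proof.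
move=> Xx cx r0; have [s1 s10 H1] := cdom_near Xx cx.
have [s2 s20 H2] := continuous_dist
  (differentiable_continuous (cpi_diff Xx cx).1) r0.
exists (Num.min s1 s2) => [|y]; first by rewrite lt_min s10.
rewrite -ball_normE /= lt_min => /andP[y1 y2].
have [|Xy cy] := H1 y; first by rewrite -ball_normE.
by split => //; rewrite distrC; apply: H2; rewrite distrC.
Qed.

Lemma pull_is_diff c x (f : E -> R) : X x -> cdom c (pi x) ->
  is_diff (cpi c x) f (covec (theta c (cpi c x))) -> is_diff x (f \o cpi c)
    (covec (alpha x)).
Proof.
move=> Xx cx fd; rewrite (alphaE Xx cx).
exact: is_diff_covec_comp (cpi_diff Xx cx).1 fd.
Qed.

(** The map pi has only one derivative, so alpha may not be differentiable and
    [closed_form_primitive] does not apply to it. Its local primitives are those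
    of theta in charts of M, composed with pi. *)
Lemma lee_potential x0 : X x0 -> exists Phi : E -> R,
  forall x, X x -> is_diff x Phi (covec (alpha x)).
Proof.
move=> X0; apply: (@global_primitive _ _ X (fun x => covec (alpha x)) X_convex _
  x0 X0 X_open) => x Xx.
have cx := chart_atP (pi x); set c := chart_at _ in cx.
have [r r0 [_ [f fP]]] := chart_primitive (cpi_image cx).
have [s s0 sP] := cpi_near Xx cx r0.
exists s => //; exists (f \o cpi c) => y /sP[Xy cy yr].
by apply: pull_is_diff => //; exact: fP.
Qed.

Lemma lee_norm2_change c d x : X x -> cdom c (pi x) -> cdom d (pi x) ->
  lee_norm2 g theta c (cpi c x) = lee_norm2 g theta d (cpi d x).
Proof.
move=> Xx cx dx; have [ov E1 _] := cpi_change Xx cx dx.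
case: (lckP) => [[[_ gl] _ _ _] [[_ tl] _] _ _ _].
rewrite /lee_norm2 E1; apply: lee_norm_change (gl _ _ _ ov) (tl _ _ _ ov).
  exact: (g_unit lckP (cpi_image cx)).
by rewrite -E1; exact: (g_unit lckP (cpi_image dx)).
Qed.

(** The pullback of |theta|^2 to X has zero differential, and X is convex. *)
Lemma lee_norm2_const c d x y : X x -> X y -> cdom c (pi x) -> cdom d (pi y) ->
  lee_norm2 g theta c (cpi c x) = lee_norm2 g theta d (cpi d y).
Proof.
pose nu z := lee_norm2 g theta (chart_at (pi z)) (cpi (chart_at (pi z)) z).
have nuE b z : X z -> cdom b (pi z) -> nu z = lee_norm2 g theta b (cpi b z).
  by move=> Xz bz; apply: lee_norm2_change => //; exact: chart_atP.
move=> Xx Xy cx dy; rewrite -nuE // -(nuE d y) //.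
apply: (diff0_constant X_convex) => // z Xz.
have bz := chart_atP (pi z); set b := chart_at _ in bz.
have [r r0 rb] := cdom_near Xz bz.
apply: (@near_eq_is_diff _ _ _ (lee_norm2 g theta b \o cpi b) nu _ _ r r0).
  by move=> w /rb[Xw bw]; rewrite (nuE b w).
have d1 := differentiableP (cpi_diff Xz bz).1.
have d2 := lee_norm2_diff0 lckP parP (cpi_image bz).
exact: (is_diff_eq (is_diff_comp d1 d2)).
Qed.

Lemma lee_norm2_gt0 c x : (forall p, exists2 z, X z & pi z = p) -> X x ->
    cdom c (pi x) ->
  0 < lee_norm2 g theta c (cpi c x).
Proof.
move=> surj Xx cx; case: (lckP) => [_ _ _ tn0 _].
(* The form theta is nonzero at some point of M, where the constant |theta|^2
   can be evaluated. *)
have [d [_ [[q dq <-] t0]]] : exists d y, cimage d y /\ theta d y != 0.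
  apply: contrapT => H; apply: tn0 => d y dy; apply/eqP/negPn/negP => t0.
  by apply: H; exists d, y.
have [z Xz zq] := surj q; rewrite -zq in dq t0.
rewrite (lee_norm2_const Xx Xz cx dq); apply: (lee_norm2_pos lckP) => //.
exact: cpi_image.
Qed.

(** As pi \o ga = pi, the form alpha is invariant under ga. So Phi \o ga is a
    primitive of alpha as well, and differs from Phi by a constant. *)
Lemma deck_potential_shift (ga : E -> E) (Phi : E -> R) :
  (forall x, X x -> is_diff x Phi (covec (alpha x))) ->
  (forall x, X x -> X (ga x)) -> (forall x, X x -> pi (ga x) = pi x) ->
  (forall x, differentiable ga x) ->
  forall x y, X x -> X y -> Phi (ga y) - Phi (ga x) = Phi y - Phi x.
Proof.
move=> PhiP gaX gapi gad x y Xx Xy.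
apply: (same_primitive X_convex (f := Phi \o ga)
  (al := fun x => covec (alpha x))) => // z Xz.
have cz := chart_atP (pi z); set c := chart_at _ in cz.
have cgz : cdom c (pi (ga z)) by rewrite gapi.
have [kd _] := cpi_diff (gaX _ Xz) cgz.
have E : jacobian ga z *m alpha (ga z) = alpha z.
  have [r r0 rX] := X_open Xz.
  have ce w : ball z r w -> (cpi c \o ga) w = cpi c w.
    by move=> /rX Xw; rewrite /cpi /= gapi.
  have [_ J2] := near_eq_jacobian r0 ce (differentiable_comp (gad z) kd).
  have cgz_eq : cpi c (ga z) = cpi c z by rewrite /cpi /= gapi.
  have J3 := etrans (esym (jacobian_comp (gad z) kd)) (esym J2).
  transitivity (jacobian ga z *m pull_theta c (ga z)).
    exact: (congr1 (mulmx (jacobian ga z)) (alphaE (gaX _ Xz) cgz)).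
  transitivity (pull_theta c z); last exact: esym (alphaE Xz cz).
  apply: etrans (mulmxA _ _ _) _; rewrite cgz_eq.
  exact: (congr1 (mulmx^~ _) J3).
rewrite -E; exact: is_diff_covec_comp (gad z) (PhiP _ (gaX _ Xz)).
Qed.

End Pullback.

(** * No minimum of the potential along complex lines *)

(** If df = theta then be is the gradient of psi = exp (- f), and H is the
    Hessian psi (theta theta^T - Hess f) of psi at x. *)
Lemma lee_hessian (R : realType) (n : nat) (M : complexManifold R n)
    (g : bilinear_components M) (theta : one_form_components M) c (x :
      'rV[R]_(n + n))
    (f : 'rV[R]_(n + n) -> R) : lck_with_lee_form g theta -> cimage c x ->
  is_diff x f (covec (theta c x)) ->
  let be := fun y => - expR (- f y) *: theta c y in
  let H := expR (- f x) *: (theta c x *m (theta c x)^T - dlee theta c x) in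
  forall e : R, 0 < e -> exists2 d : R, 0 < d & forall h : 'rV[R]_(n + n),
    `|h| < d ->
      `|be (x + h) - be x - (h *m H)^T| <= e * `|h|.
Proof.
move=> lckP cx fd be H.
pose E := fun y => - expR (- f y).
have Ed : is_diff x E (fun h => expR (- f x) * covec (theta c x) h).
  have d1 := is_diffN fd.
  have d2 := is_diff_of_derive (is_derive_expR (- f x)).
  have d3 := is_diffN (is_diff_comp d1 d2).
  apply: (is_diff_eq d3); apply/funext => h.
  rewrite -[LHS]/(- (- covec (theta c x) h * expR (- f x))).
  by rewrite mulNr opprK mulrC.
have bd k : is_diff x (fun y => be y k 0) (covec (\col_i H i k)).
  have td := partials_is_diff (theta_diff lckP k cx).
  have d := is_diffM Ed td.
  have -> : (fun y => be y k 0) = E * (fun y => theta c y k 0).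
    by apply/funext => y; rewrite /be mxE.
  apply: (is_diff_eq d); apply/funext => h.
  rewrite -[LHS]/(E x * covec (\col_i partial i (fun y => theta c y k 0) x) h
     + theta c x k 0 * (expR (- f x) * covec (theta c x) h)).
  rewrite !covecE /E !mulr_sumr -big_split; apply: eq_bigr => i _ /=.
  by rewrite /H !mxE big_ord1 !mxE; ring.
have bdiff k : differentiable (fun y => be y k 0) x
  by exact: (@ex_diff _ _ _ _ _ _ _ (bd k)).
have -> : H = \matrix_(i, k) partial i (fun y => be y k 0) x.
  by apply/matrixP => i k; rewrite [RHS]mxE (partial_is_diff i (bd k)) [RHS]mxE.
exact: column_expansion.
Qed.

Section LeafMinimum.
Variables (R : realType) (n : nat) (M : complexManifold R n).
Variables (X : set 'rV[R]_(n + n)) (pi : 'rV[R]_(n + n) -> M).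
Variables (g : bilinear_components M) (theta : one_form_components M).
Hypothesis lckP : lck_with_lee_form g theta.
Hypothesis parP : forall c x, cimage c x -> forall i j,
  cov_deriv g theta c x i j = 0.
Hypothesis X_convex : segment_convex X.
Hypothesis X_open : forall x, X x -> exists2 r : R, 0 < r & ball x r `<=` X.
Hypothesis pi_bihol : locally_biholomorphic_on X pi.
Hypothesis pi_surj : forall p : M, exists2 x, X x & pi x = p.
Local Notation E := 'rV[R]_(n + n).
Local Notation J := (Jmx R n).

(** With f a primitive of theta in a chart around pi p, the Levi form of
    exp (- f) at pi p is exp (- f) |theta|^2 g by [chart_levi], hence positive.
    So exp (- f) has no maximum, and Phi = f \o pi + constant no minimum, along
    the complex line. *)
Lemma no_leaf_minimum (Phi : E -> R) (p e : E) :
  (forall x, X x -> is_diff x Phi (covec (alpha pi theta x))) -> X p ->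
    e != 0 ->
  ~ (forall a b : R, X (p + a *: e + b *: (e *m J)) ->
       Phi p <= Phi (p + a *: e + b *: (e *m J))).
Proof.
move=> PhiP Xp e0 Pmin.
have [pi_holo pi_loc] := pi_bihol.
have cp := chart_atP (pi p); set c := chart_at _ in cp.
have cip := cpi_image cp.
have [r r0 [rc [f fP]]] := chart_primitive lckP cip.
have [s1 s10 H1] := cpi_near X_open pi_holo Xp cp r0.
have [V [h [[Vo Vp _] [_ hV _]]]] := pi_loc p Xp.
have [s2 s20 H2] := open_ball Vo Vp.
pose s := Num.min s1 s2.
have s0 : 0 < s by rewrite lt_min s10.
have bs z : ball p s z -> ball p s1 z /\ ball p s2 z.
  by rewrite -!ball_normE /= lt_min => /andP.
have PhiE z : ball p s z -> Phi z - Phi p = f (cpi pi c z) - f (cpi pi c p).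
  move=> zs; apply: (same_primitive (@ball_convex _ _ p s) (g := f \o cpi pi c)
    (al := fun x => covec (alpha pi theta x))) => //; last exact: ballxx.
    by move=> w /bs[/H1[Xw _ _] _]; exact: PhiP.
  move=> w /bs[/H1[Xw cw wr] _].
  have wd := pull_is_diff lckP X_open pi_holo Xw cw (fP _ wr).
  exact: wd.
pose F y := expR (- f y).
pose be := fun y => - expR (- f y) *: theta c y.
pose H := expR (- f (cpi pi c p)) *:
  (theta c (cpi pi c p) *m (theta c (cpi pi c p))^T
   - dlee theta c (cpi pi c p)).
apply: (@strictly_psh_not_max R n n (cpi pi c) p e s s0 e0 _ _ F be H r r0 _ _ _
  _).
- by move=> z /bs[/H1[Xz cz _] _]; exact: (cpi_diff pi_holo Xz cz).
- move=> z /bs[/H1[Xz cz _] /H2 zV] kz; rewrite -(hV z zV) -(hV p Vp);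
  congr (h _).
  by rewrite -(cchartK cz) -(cchartK cp); congr (cinv c _).
- move=> y yr; have fd := fP y yr.
  have d2 := is_diff_of_derive (is_derive_expR (- f y)).
  apply: (is_diff_eq (is_diff_comp (is_diffN fd) d2)); apply/funext => v.
  rewrite -[LHS]/(- covec (theta c y) v * expR (- f y)) /be /covec -scalemxAr
    [RHS]mxE.
  by rewrite mulNr mulrC mulNr.
- by rewrite /H linearZ linearB /= trmx_mul trmxK (dlee_sym lckP cip).
- exact: (lee_hessian lckP cip (fP _ (ballxx _ r0))).
- move=> v v0.
  have Hbil w : covec (H *m w^T) w = expR (- f (cpi pi c p)) *
      (covec (theta c (cpi pi c p)) w ^+ 2 - bil (dlee theta c (cpi pi c p)) w
        w).
    rewrite /H /covec -scalemxAl -scalemxAr mxE; congr (_ * _).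
    rewrite mulmxBl mulmxBr mxE; congr (_ + _); last by rewrite mxE /bil mulmxA.
    have -> : w *m (theta c (cpi pi c p) *m (theta c (cpi pi c p))^T *m w^T) =
        (w *m theta c (cpi pi c p)) *m (w *m theta c (cpi pi c p))^T.
      by rewrite trmx_mul !mulmxA.
    by rewrite mxE big_ord1 [(_^T) _ _]mxE expr2.
  rewrite !Hbil -mulrDr mulr_gt0 ?expR_gt0 //.
  have := chart_levi lckP parP v cip.
  have : 0 < lee_norm2 g theta c (cpi pi c p) * bil (g c (cpi pi c p)) v v.
    apply: mulr_gt0; last exact: (g_pos lckP cip).
    exact: (lee_norm2_gt0 lckP parP X_convex X_open pi_holo pi_surj Xp cp).
  lra.
move=> a b zs; rewrite /F ler_expR lerN2.
have [/H1[Xz _ _] _] := bs _ zs.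
by have := PhiE _ zs; have := Pmin a b Xz; lra.
Qed.

End LeafMinimum.

(** * The action on the product of half-planes and lines *)

Lemma row_ext (R : realType) (n : nat) (x y : 'rV[R]_(n + n)) :
  (forall j, x 0 (lshift n j) = y 0 (lshift n j)) ->
  (forall j, x 0 (rshift n j) = y 0 (rshift n j)) -> x = y.
Proof.
by move=> h1 h2; apply/rowP => k; rewrite -[k]fintype.splitK;
  case: (fintype.split k) => j /=.
Qed.

Section OTAction.
Variables (R : realType) (s t : nat) (K : fieldExtType rat).
Variable sigma : 'I_(s + t + t) -> {rmorphism K -> R[i]}.
Hypothesis sigmaP : ordered_embeddings sigma.
Local Notation n := (s + t)%N.
Local Notation E := 'rV[R]_(n + n).
Local Notation sg j := (sigma (lshift t j)).
Local Notation act := (ot_action sigma).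

(** The vector by which b translates. *)
Definition embed (b : K) : E := of_complex (\row_(j < n) sg j b).

Lemma ot_action_re a b (x : E) j : act a b x 0 (lshift n j) =
  complex.Re (sg j a) * x 0 (lshift n j) - complex.Im (sg j a)
    * x 0 (rshift n j)
  + complex.Re (sg j b).
Proof.
rewrite /ot_action /of_complex row_mxEl !mxE.
by case: (sg j a) => p q; case: (sg j b).
Qed.

Lemma ot_action_im a b (x : E) j : act a b x 0 (rshift n j) =
  complex.Re (sg j a) * x 0 (rshift n j) + complex.Im (sg j a)
    * x 0 (lshift n j)
  + complex.Im (sg j b).
Proof.
rewrite /ot_action /of_complex row_mxEr !mxE.
by case: (sg j a) => p q; case: (sg j b).
Qed.

Lemma embed_re b j : embed b 0 (lshift n j) = complex.Re (sg j b).
Proof. by rewrite /embed /of_complex row_mxEl !mxE. Qed.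

Lemma embed_im b j : embed b 0 (rshift n j) = complex.Im (sg j b).
Proof. by rewrite /embed /of_complex row_mxEr !mxE. Qed.

Lemma embedD b b' : embed (b + b') = embed b + embed b'.
Proof.
apply: row_ext => j; rewrite [RHS]mxE ?embed_re ?embed_im rmorphD;
  by case: (sg j b); case: (sg j b').
Qed.

Lemma embed0 : embed 0 = 0.
Proof. by apply: (addrI (embed 0)); rewrite -embedD !addr0. Qed.

Lemma embedN b : embed (- b) = - embed b.
Proof. by apply: (addrI (embed b)); rewrite -embedD !subrr embed0. Qed.

Lemma embedMn b k : embed (b *+ k) = embed b *+ k.
Proof. by elim: k => [|k IH]; rewrite ?mulr0n ?embed0 // !mulrS embedD IH. Qed.

Lemma embedMz b (m : int) : embed (m%:~R * b) = m%:~R *: embed b.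
Proof.
rewrite mulrzl scaler_int; case: m => k; first exact: embedMn.
by rewrite !NegzE !mulrNz embedN embedMn.
Qed.

Lemma embed_sum (N : nat) (F : 'I_N -> K) : embed (\sum_k F k) =
    \sum_k embed (F k).
Proof.
elim/big_rec2: _ => [|k y1 y2 _ <-]; first exact: embed0.
exact: embedD.
Qed.

Lemma translationE b x : act 1 b x = x + embed b.
Proof.
apply: row_ext => j; rewrite [RHS]mxE ?embed_re ?embed_im ?ot_action_re
  ?ot_action_im rmorph1 /=;
  by rewrite mul1r mul0r ?subr0 ?addr0.
Qed.

Lemma ot_actionE a b x : act a b x = act a 0 x + embed b.
Proof.
apply: row_ext => j; rewrite [RHS]mxE ?embed_re ?embed_im ?ot_action_re
  ?ot_action_im rmorph0 /=;
  by rewrite addr0.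
Qed.

Lemma homothety_embed a b x : act a 0 (x + embed b) = act a 0 x + embed (a * b).
Proof.
apply: row_ext => j; rewrite [RHS]mxE ?embed_re ?embed_im ?ot_action_re
  ?ot_action_im;
  rewrite ![(x + embed b) _ _]mxE embed_re embed_im rmorph0 rmorphM;
    case: (sg j a) => p q; case: (sg j b) => u v /=; ring.
Qed.

Lemma homothety_linear a : linear (act a 0).
Proof.
move=> k u v; apply: row_ext => j; rewrite 2![in RHS]mxE ?ot_action_re
  ?ot_action_im;
  rewrite !mxE rmorph0 /=; ring.
Qed.

Lemma ot_action_differentiable a b x : differentiable (act a b) x.
Proof.
pose LM := GRing.isLinear.Build _ _ _ _ _ (homothety_linear a).
pose L : {linear E -> E} := HB.pack (act a 0) LM.
have -> : act a b = (fun y => y *m lin1_mx L + embed b).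
  by apply/funext => y; rewrite mul_rV_lin1 ot_actionE.
exact: affine_differentiable.
Qed.

Lemma ot_domainE (x : E) : ot_domain x <-> forall i : 'I_s, 0 <
    x 0 (rshift n (lshift t i)).
Proof. by split => xX i; have := xX i; rewrite /ot_domain /= mxE. Qed.

Lemma ot_domain_convex : segment_convex (@ot_domain R s t).
Proof.
move=> x y k /ot_domainE xX /ot_domainE yX /andP[k0 k1]; apply/ot_domainE => i.
rewrite !mxE; have := convex_comb_lt k0 k1 (x := - x 0 (rshift n (lshift t i)))
  (y := - y 0 (rshift n (lshift t i))) (d := 0).
by rewrite !oppr_lt0 => /(_ (xX i) (yX i)); lra.
Qed.

Lemma ot_domain_open (x : E) : ot_domain x -> exists2 r : R, 0 < r &
    ball x r `<=` @ot_domain R s t.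
Proof.
move=> /ot_domainE xX.
exists (\big[Num.min/1]_(i < s) x 0 (rshift n (lshift t i))).
  by apply/bigmin_gtP; split.
move=> y; rewrite -ball_normE /= => xy; apply/ot_domainE => i.
have /bigmin_gtP[_ /(_ i isT)] := xy.
have := coord_le_norm (x - y) 0 (rshift n (lshift t i)); rewrite !mxE.
move=> /le_lt_trans h /h; rewrite ltr_norml => /andP[]; lra.
Qed.

Lemma embed_real b (i : 'I_s) : embed b 0 (rshift n (lshift t i)) = 0.
Proof. by rewrite embed_im; case: sigmaP => _ re _ _; exact: re. Qed.

Lemma ot_domain_action U a b x : admissible_subgroup sigma U -> U a ->
  ot_domain x -> ot_domain (act a b x).
Proof.
move=> [Upos _ _ _] /Upos[_ apos] /ot_domainE xX; apply/ot_domainE => i.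
have [_ re _ _] := sigmaP.
rewrite ot_action_im !re mul0r !addr0; apply: mulr_gt0 (xX i).
by have := apos i; rewrite ltcE => /andP[].
Qed.

(** U has rank s > 0, and 1 is not independent. *)
Lemma nontrivial_unit U : (0 < s)%N -> admissible_subgroup sigma U -> exists2 a,
    U a & a != 1.
Proof.
move=> s0 [_ _ [[a aU ai] _] _]; pose i0 := Ordinal s0.
exists (a i0) => //; apply/eqP => a1.
have := ai (fun i => if i == i0 then 1 else 0) _ i0; rewrite eqxx => H.
suff : (1 : int) = 0 by [].
apply: H; apply: big1 => i _; case: eqP => [->|_]; last by rewrite expr0z.
by rewrite a1 exp1rz.
Qed.

End OTAction.

(** * Oeljeklaus-Toma manifolds *)

Section Periods.
Variables (R : realType) (s t : nat) (K : fieldExtType rat).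
Variable sigma : 'I_(s + t + t) -> {rmorphism K -> R[i]}.
Hypothesis sigmaP : ordered_embeddings sigma.
Variable U : set K.
Hypothesis UP : admissible_subgroup sigma U.
Local Notation n := (s + t)%N.
Local Notation E := 'rV[R]_(n + n).
Local Notation X := (@ot_domain R s t).
Local Notation emb := (embed sigma).
Variable Phi : E -> R.
Hypothesis deck : forall a b x y, U a -> algebraic_integers b -> X x -> X y ->
  Phi (ot_action sigma a b y) - Phi (ot_action sigma a b x) = Phi y - Phi x.

Lemma ot_domain_embed b (x : E) : X x -> X (x + emb b).
Proof.
move=> /ot_domainE xX; apply/ot_domainE => i.
by rewrite mxE (embed_real sigmaP) addr0.
Qed.

(** The identity (a, 0) (1, b) = (1, a b) (a, 0) shows that Phi changes by the
    same constant under the translations by b and by a b, so it is invariant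
    under their quotient. *)
Lemma potential_period a b x : U a -> algebraic_integers b -> X x ->
  Phi (x + emb ((a - 1) * b)) = Phi x.
Proof.
move=> Ua bi Xx.
have [Upos [U1 _] _ _] := UP.
have [[_ ai _] _] := Upos a Ua.
have abi : algebraic_integers (a * b) by exact: mxpoly.integral_mul.
have i0 : algebraic_integers (0 : K) by exact: mxpoly.integral0.
pose y := x + emb (- b).
have Xy : X y by exact: ot_domain_embed.
have yb : y + emb b = x by rewrite /y embedN subrK.
have XA : X (ot_action sigma a 0 y) by exact: (ot_domain_action sigmaP _ UP).
have h1 := deck Ua i0 Xy Xx.
rewrite -[in LHS]yb homothety_embed -translationE in h1.
have h2 := deck U1 abi Xy XA; rewrite translationE in h2.
have -> : x + emb ((a - 1) * b) = ot_action sigma 1 (a * b) y.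
  by rewrite translationE /y mulrBl mul1r embedD addrAC -addrA.
move: h1 h2; rewrite -!translationE.
move: (Phi _) (Phi _) (Phi _) (Phi _) (Phi _) => p1 p2 p3 p4 p5; lra.
Qed.

End Periods.

Lemma Re_sum (R : realType) (N : nat) (u : 'I_N -> R) (z : 'I_N -> R[i]) :
  complex.Re (\sum_k ((u k)%:C)%C * z k) = \sum_k u k * complex.Re (z k).
Proof.
elim/big_rec2: _ => // k y1 y2 _ <-; case: (z k) => p q; case: y2 => p2 q2 /=.
by rewrite mul0r subr0.
Qed.

Lemma Im_sum (R : realType) (N : nat) (u : 'I_N -> R) (z : 'I_N -> R[i]) :
  complex.Im (\sum_k ((u k)%:C)%C * z k) = \sum_k u k * complex.Im (z k).
Proof.
elim/big_rec2: _ => // k y1 y2 _ <-; case: (z k) => p q; case: y2 => p2 q2 /=.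
by rewrite mul0r addr0.
Qed.

Lemma delta_mulJ (R : realType) (n : nat) (j : 'I_n) :
  (delta_mx 0 (lshift n j) : 'rV[R]_(n + n)) *m Jmx R n =
    delta_mx 0 (rshift n j).
Proof.
rewrite -rowE; apply: row_ext => k; rewrite [LHS]mxE /Jmx ?block_mxEul
  ?block_mxEur !mxE eqxx.
  by rewrite eq_lrshift.
by rewrite (inj_eq (@rshift_inj _ _)) eq_sym.
Qed.

Theorem corollary1p3 (R : realType) (s t : nat) (s_gt0 : (0 < s)%N)
    (t_gt0 : (0 < t)%N) (K : fieldExtType rat)
    (dimK : \dim {:K} = (s + 2 * t)%N)
    (sigma : 'I_(s + t + t) -> {rmorphism K -> R[i]})
    (sigmaP : ordered_embeddings sigma)
    (U : set K) (UP : admissible_subgroup sigma U)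
    (M : complexManifold R (s + t)) (MP : is_OT_manifold sigma U M) :
  ~ admits_vaisman_metric M.
Proof.
move=> [g [theta lckP parP]]; have [pi [surj fib bihol]] := MP.
set X := @ot_domain R s t in surj fib bihol.
have [pi_holo _] := bihol.
(* Any point of X; it selects the fibre on which Phi is minimised. *)
pose p0 : 'rV[R]_((s + t) + (s + t)) := const_mx 1.
have Xp0 : X p0 by apply/ot_domainE => i; rewrite mxE.
have [Phi PhiP] := lee_potential lckP (@ot_domain_convex R s t)
  (@ot_domain_open R s t) pi_holo Xp0.
have deck a b x y : U a -> algebraic_integers b -> X x -> X y ->
    Phi (ot_action sigma a b y) - Phi (ot_action sigma a b x) = Phi y - Phi x.
  move=> Ua bi Xx Xy.
  have aX z : X z -> X (ot_action sigma a b z)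
    by exact: (ot_domain_action sigmaP _ UP).
  apply: (deck_potential_shift lckP (@ot_domain_convex R s t)
    (@ot_domain_open R s t) pi_holo PhiP aX) => //.
    by move=> z Xz; apply/esym/fib => //; [exact: aX|exists a, b].
  by move=> z; exact: ot_action_differentiable.
have [a Ua a1] := nontrivial_unit s_gt0 UP.
have d0 : a - 1 != 0 by rewrite subr_eq0.
have dimE : \dim {:K} = (s + t + t)%N by rewrite dimK mul2n -addnn addnA.
(* The rows of B span a lattice of periods of Phi, of full rank in the tangent
   space R^s x C^t of the fibre. *)
have [b bi bspan] := integral_spanning_family dimE d0.
pose B := \matrix_(k < s + t + t) embed sigma ((a - 1) * b k).
have BE c : c *m B = \sum_k c 0 k *: embed sigma ((a - 1) * b k).
  by rewrite mulmx_sum_row; apply: eq_bigr => k _; rewrite rowK.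
have XB x c : X x -> X (x + c *m B).
  move=> /ot_domainE xX; apply/ot_domainE => i; rewrite mxE BE summxE big1
    ?addr0 // => k _.
  by rewrite mxE (embed_real sigmaP) mulr0.
have PhiB x (m : 'I_(s + t + t) -> int) : X x ->
    Phi (x + (\row_k (m k)%:~R) *m B) = Phi x.
  move=> Xx.
  have -> : (\row_k (m k)%:~R) *m B = embed sigma ((a - 1)
    * \sum_k (m k)%:~R * b k).
    rewrite BE mulr_sumr embed_sum; apply: eq_bigr => k _.
    by rewrite mxE -embedMz mulrCA.
  apply: (potential_period sigmaP UP deck Ua _ Xx).
  rewrite /algebraic_integers /=; elim/big_rec: _ => [|k y _ yi];
    first exact: mxpoly.integral0.
  by apply: mxpoly.integral_add => //; apply: mxpoly.integral_mul;
    [exact: mxpoly.integral_id|exact: bi].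
pose Psi c := Phi (p0 + c *m B).
have cPsi : continuous Psi.
  move=> c; apply: differentiable_continuous.
  have gd : differentiable (fun c => c *m B +
    p0) c by exact: affine_differentiable.
  have Xc : X (c *m B + p0) by rewrite addrC; exact: XB.
  have Pd : differentiable Phi (c *m B + p0)
    by exact: (@ex_diff _ _ _ _ _ _ _ (PhiP _ Xc)).
  have -> : Psi = Phi \o (fun c => c *m B + p0) by apply/funext => z;
    rewrite /Psi /= addrC.
  exact: differentiable_comp gd Pd.
(* The cube [0, 1]^(s + 2t) for the sup norm; it contains a fundamental domain
   of the torus. *)
pose box : set 'rV[R]_(s + t + t) := cball (const_mx 2^-1) 2^-1.
have [c cbox cmin] : exists2 c, c \in box & forall u, u \in box -> Psi c <=
  Psi u.
  apply: EVT_min_rV; first by exists (const_mx 2^-1);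
    rewrite /box /cball /= subrr normr0 invr_ge0.
    exact: cball_compact.
  exact: continuous_subspaceT.
have cglob u : Psi c <= Psi u.
  (* Subtracting integral parts moves u into the cube and does not change
     Psi. *)
  pose m k := Num.floor (u 0 k).
  have -> : Psi u = Psi (u - \row_k (m k)%:~R).
    rewrite /Psi -[RHS](PhiB _ m); last exact: XB.
    by congr Phi; rewrite mulmxBl -addrA subrK.
  apply: cmin; rewrite inE /box /cball /=.
  rewrite [leLHS]/Num.Def.normr /= mx_normrE; apply/bigmax_leP;
    split => [|[i k] _ /=].
    by rewrite invr_ge0.
  rewrite (ord1 i) !mxE ler_norml.
  have := floor_itv (u 0 k); rewrite -/(m k) intrD => /andP[]; lra.
(* The direction of the first coordinate z_1 of C^t. The complex line through
   the minimum in this direction stays in the fibre, so all its points are of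
   the form p0 + u B. *)
pose j0 := rshift s (Ordinal t_gt0).
pose e : 'rV[R]_((s + t) + (s + t)) := delta_mx 0 (lshift (s + t) j0).
have e0 : e != 0.
  apply/eqP => /rowP /(_ (lshift (s + t) j0)); rewrite !mxE !eqxx; apply/eqP;
    exact: oner_neq0.
have eJ : e *m Jmx R (s + t) = delta_mx 0 (rshift (s + t) j0).
  exact: delta_mulJ.
apply: (no_leaf_minimum lckP parP (@ot_domain_convex R s t)
  (@ot_domain_open R s t) bihol surj PhiP
  (XB _ c Xp0) e0).
move=> x y _.
pose w (j : 'I_(s + t)) : R[i] := if j == j0 then (x +i* y)%C else 0.
have [|u uw] := embeddings_span sigmaP bspan (w := w).
  by move=> i; rewrite /w /j0 eq_lrshift.
have -> : p0 + c *m B + x *: e + y *: (e *m Jmx R (s + t)) =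
  p0 + (c + \row_k u k) *m B.
  rewrite mulmxDl -!addrA; congr (_ + (_ + _)); rewrite eJ BE.
  have uE j : \sum_k ((u k)%:C)%C * sigma (lshift t j) ((a - 1) * b k) =
    w j by rewrite uw.
  apply: row_ext => j; rewrite summxE.
    transitivity (complex.Re (w j)); last first.
      by rewrite -uE Re_sum; apply: eq_bigr => k _;
        rewrite [RHS]mxE embed_re mxE.
    rewrite !mxE !eqxx (inj_eq (@lshift_inj _ _)) eq_lrshift /w andbF mulr0
      addr0.
    by case: eqP => _; rewrite ?mulr1 ?mulr0.
  transitivity (complex.Im (w j)); last first.
    by rewrite -uE Im_sum; apply: eq_bigr => k _; rewrite [RHS]mxE embed_im mxE.
  rewrite !mxE !eqxx (inj_eq (@rshift_inj _ _)) eq_rlshift /w andbF mulr0 add0r.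
  by case: eqP => _; rewrite ?mulr1 ?mulr0.
exact: cglob.
Qed.
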